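(* Let $\Omega\subset\mathbb{R}^2$ be a bounded polygon, $T>0$, $k:\overline\Omega\to\mathbb{R}$ with $0<k_1\le k(\boldsymbol x)\le k_2$ for constants $k_1,k_2$, $\mu:\partial\Omega\to\mathbb{R}$ with $\mu\ge 0$, and let $f:\overline\Omega\times[0,T]\to\mathbb{R}$ satisfy $$f(\boldsymbol x,0)=0,\qquad \frac{\partial f}{\partial t}(\boldsymbol x,t)>0,\qquad \boldsymbol x\in\Omega,\ 0<t\le T.$$ Write $\mathcal{A}v=-\operatorname{div}(k(\boldsymbol x)\operatorname{grad}v)$ for functions $v$ satisfying the boundary condition $k\,\frac{\partial v}{\partial n}+\mu v=0$ on $\partial\Omega$. Let $(u,c)$ be a solution of the inverse problem with final data $\psi$, that is, $c=c(\boldsymbol x)\ge 0$ in $\Omega$ and $$\frac{\partial u}{\partial t}+\mathcal{A}u+c(\boldsymbol x)u=f(\boldsymbol x,t),\quad \boldsymbol x\in\Omega,\ 0<t\le T,$$ $$k\,\frac{\partial u}{\partial n}+\mu u=0,\quad \boldsymbol x\in\partial\Omega,\ 0<t\le T,$$ $$u(\boldsymbol x,0)=0,\qquad u(\boldsymbol x,T)=\psi(\boldsymbol x),\quad \boldsymbol x\in\Omega,$$ where $\psi(\boldsymbol x)>0$ for $\boldsymbol x\in\Omega$. Let the sequences $(c^k)_{k\ge0}$ and $(u^k)_{k\ge0}$ (where the superscript $k$ is the iteration number) be generated as follows. The initial approximation $c^0$ is defined by $$c^0(\boldsymbol x)\,\psi(\boldsymbol x)=-\mathcal{A}\psi(\boldsymbol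 x)+f(\boldsymbol x,T),\quad \boldsymbol x\in\Omega.$$ For each $k=0,1,2,\dots$, given $c^k$, the function $u^k$ is the solution of $$\frac{\partial u^k}{\partial t}+\mathcal{A}u^k+c^k(\boldsymbol x)u^k=f(\boldsymbol x,t),\quad \boldsymbol x\in\Omega,\ 0<t\le T,\qquad u^k(\boldsymbol x,0)=0,\quad \boldsymbol x\in\Omega,$$ with the same boundary condition $k\,\frac{\partial u^k}{\partial n}+\mu u^k=0$ on $\partial\Omega$ for $0<t\le T$, and $c^{k+1}$ is defined by $$c^{k+1}(\boldsymbol x)\,\psi(\boldsymbol x)=-\frac{\partial u^k}{\partial t}(\boldsymbol x,T)-\mathcal{A}\psi(\boldsymbol x)+f(\boldsymbol x,T),\quad \boldsymbol x\in\Omega.$$ Assume that all the functions involved are sufficiently smooth (in the sense specified in the context). Then the iterative process is monotone: for all $k=1,2,\dots$, $$u(\boldsymbol x,t)\ge u^k(\boldsymbol x,t)\ge u^{k-1}(\boldsymbol x,t),\qquad c(\boldsymbol x)\le c^k(\boldsymbol x)\le c^{k-1}(\boldsymbol x),\qquad \boldsymbol x\in\Omega,\ 0<t\le T.$$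
   Context: Here $\boldsymbol x=(x_1,x_2)$, $\frac{\partial}{\partial n}$ is the derivative along the outward unit normal to $\partial\Omega$ (boundary conditions are understood at boundary points other than the vertices of the polygon), and the diffusion coefficient $k(\boldsymbol x)$ is not to be confused with the iteration index $k$, which appears only as a superscript or index. Smoothness convention: the solutions, the coefficients and the boundary data are assumed to have all derivatives with respect to space and time that are needed. Concretely: $k\in C^1(\overline\Omega)$; $\mu$ is bounded and continuous on each open edge of the polygon; $f$ and $\partial f/\partial t$ are continuous on $\overline\Omega\times[0,T]$; $c$ and all $c^k$ extend to continuous functions on $\overline\Omega$; and each of the functions $v=u$ and $v=u^k$ $(k\ge0)$, together with its time derivative $\partial v/\partial t$, is once continuously differentiable in $t$ and twice continuously differentiable in $\boldsymbol x$ on $\overline\Omega\times[0,T]$. In particular all equations are understood in the classical sense, and $\psi=u(\cdot,T)$ satisfies the boundary condition $k\,\frac{\partial\psi}{\partial n}+\mu\psi=0$. The existence of the solution $(u,c)$ and of the iterates $u^k,c^k$ with this regularity is part of the hypotheses. *)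

(* Defs.v *)
From HB Require Import structures.
From mathcomp Require Import all_boot all_order all_algebra.
From mathcomp Require Import all_classical all_reals all_analysis.

Set Implicit Arguments.
Unset Strict Implicit.
Unset Printing Implicit Defensive.

Import Order.TTheory GRing.Theory Num.Theory.
Import numFieldNormedType.Exports.
Local Open Scope classical_set_scope.
Local Open Scope ring_scope.

Definition bnd {S : topologicalType} (A : set S) : set S := closure A `\` interior A.

Definition edge_pt {R : realType} {n : nat} (p : 'I_n -> 'rV[R]_2)
    (i : 'I_n) (s : R) : 'rV[R]_2 :=
  (1 - s) *: p i + s *: p (ordS i).

Definition open_edge {R : realType} {n : nat} (p : 'I_n -> 'rV[R]_2)
    (i : 'I_n) : set 'rV[R]_2 :=
  edge_pt p i @` `]0, 1[.

Definition closed_edge {R : realType} {n : nat} (p : 'I_n -> 'rV[R]_2)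
    (i : 'I_n) : set 'rV[R]_2 :=
  edge_pt p i @` `[0, 1].

(* The unit vector obtained by turning the direction of the edge i clockwise
   by a right angle. The norm of the library on 'rV[R]_2 is the sup norm, hence
   the explicit Euclidean length. *)
Definition edge_normal {R : realType} {n : nat} (p : 'I_n -> 'rV[R]_2)
    (i : 'I_n) : 'rV[R]_2 :=
  let d := p (ordS i) - p i in
  (Num.sqrt (d 0 0 ^+ 2 + d 0 1 ^+ 2))^-1 *:
    \row_(j < 2) (if j == 0 then d 0 1 else - d 0 0).

(* Injectivity on the half-open edges says that the closed polygonal line
   through the vertices p is simple. A bounded connected open set with this line
   as its boundary is the interior of the line. The last condition says that the
   vertices are listed counterclockwise, so that edge_normal p i is the outward
   unit normal on the edge i; every simple polygon has such a listing. *)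
Definition polygon {R : realType} {n : nat} (p : 'I_n -> 'rV[R]_2)
    (Omega : set 'rV[R]_2) : Prop :=
  [/\ (3 <= n)%N
      /\ (forall i j s t, s \in `[0, 1[ -> t \in `[0, 1[ ->
            edge_pt p i s = edge_pt p j t -> i = j /\ s = t),
      open Omega /\ connected Omega,
      bounded_set Omega,
      bnd Omega = \bigcup_i closed_edge p i
    & forall i x, open_edge p i x ->
        \forall s \near 0^'+,
          Omega (x - s *: edge_normal p i) /\
          ~ closure Omega (x + s *: edge_normal p i)].

Definition ei {R : realType} (i : 'I_2) : 'rV[R]_2 := delta_mx 0 i.

(* f, of which only the values on D matter, extends continuously to E. *)
Definition cont_ext {R : realType} {S : topologicalType} (D E : set S)
    (f : S -> R) : Prop :=
  exists g : S -> R, {within E, continuous g} /\ {in D, f =1 g}.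

(* Time derivative of functions on [0, T]: the difference quotients only use
   times in [0, T], so the derivative is one-sided at t = 0 and at t = T. *)
Definition dt_quot {R : realType} {X : Type} (v : X -> R -> R) (x : X)
    (t s : R) : R :=
  (v x s - v x t) / (s - t).

Definition dt {R : realType} {X : Type} (T : R) (v : X -> R -> R) (x : X)
    (t : R) : R :=
  lim (dt_quot v x t s @[s --> within `[0, T] t^']).

Definition dt_derivable {R : realType} {X : Type} (T : R) (v : X -> R -> R)
    (x : X) (t : R) : Prop :=
  cvg (dt_quot v x t s @[s --> within `[0, T] t^']).

(* v and dv/dt are continuous on closure Omega x [0, T]. *)
Definition C1_time {R : realType} (Omega : set 'rV[R]_2) (T : R)
    (v : 'rV[R]_2 -> R -> R) : Prop :=
  let Q := closure Omega `*` `[0, T] in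
  [/\ {within Q, continuous (fun z : 'rV[R]_2 * R => v z.1 z.2)},
      forall x t, closure Omega x -> t \in `[0, T] -> dt_derivable T v x t
    & {within Q, continuous (fun z : 'rV[R]_2 * R => dt T v z.1 z.2)}].

Definition C1_space {R : realType} (Omega : set 'rV[R]_2)
    (g : 'rV[R]_2 -> R) : Prop :=
  [/\ {within closure Omega, continuous g},
      forall i x, Omega x -> derivable g x (ei i)
    & forall i, cont_ext Omega (closure Omega) ('D_(ei i) g)].

(* As usual for C^2 up to the boundary, the spatial derivatives of order one and
   two are taken in the open set Omega and extend continuously, jointly in (x, t),
   to closure Omega x [0, T]. *)
Definition C2_space {R : realType} (Omega : set 'rV[R]_2) (T : R)
    (v : 'rV[R]_2 -> R -> R) : Prop :=
  let D := Omega `*` `[0, T] in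
  let Q := closure Omega `*` `[0, T] in
  [/\ forall i x t, Omega x -> t \in `[0, T] -> derivable (v^~ t) x (ei i),
      forall i j x t, Omega x -> t \in `[0, T] ->
        derivable ('D_(ei i) (v^~ t)) x (ei j),
      forall i,
        cont_ext D Q (fun z : 'rV[R]_2 * R => 'D_(ei i) (v^~ z.2) z.1)
    & forall i j, cont_ext D Q
        (fun z : 'rV[R]_2 * R => 'D_(ei j) ('D_(ei i) (v^~ z.2)) z.1)].

Definition smooth {R : realType} (Omega : set 'rV[R]_2) (T : R)
    (v : 'rV[R]_2 -> R -> R) : Prop :=
  [/\ C1_time Omega T v, C2_space Omega T v,
      C1_time Omega T (dt T v) & C2_space Omega T (dt T v)].

Definition opA {R : realType} (kap : 'rV[R]_2 -> R) (v : 'rV[R]_2 -> R)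
    (x : 'rV[R]_2) : R :=
  - \sum_(i < 2) 'D_(ei i) (fun y => kap y * 'D_(ei i) v y) x.

(* Derivative at a boundary point x along the outward normal nu, computed from
   inside the domain, the only side where v is meaningful. *)
Definition normal_deriv {R : realType} (nu : 'rV[R]_2) (v : 'rV[R]_2 -> R)
    (x : 'rV[R]_2) : R :=
  lim ((v x - v (x - s *: nu)) / s @[s --> 0^'+]).

Definition robin_bc {R : realType} {n : nat} (p : 'I_n -> 'rV[R]_2)
    (kap mu : 'rV[R]_2 -> R) (v : 'rV[R]_2 -> R) : Prop :=
  forall i x, open_edge p i x ->
    kap x * normal_deriv (edge_normal p i) v x + mu x * v x = 0.

Definition solves {R : realType} {n : nat} (p : 'I_n -> 'rV[R]_2)
    (Omega : set 'rV[R]_2) (T : R) (kap mu : 'rV[R]_2 -> R)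
    (f : 'rV[R]_2 -> R -> R) (c : 'rV[R]_2 -> R)
    (v : 'rV[R]_2 -> R -> R) : Prop :=
  [/\ forall x t, Omega x -> 0 < t <= T ->
        dt T v x t + opA kap (v^~ t) x + c x * v x t = f x t,
      forall t, 0 < t <= T -> robin_bc p kap mu (v^~ t)
    & forall x, Omega x -> v x 0 = 0].

(* Main.v *)
(* The difference of two solutions of the linear problems solves a problem of the
   same kind whose right-hand side is (c' - c) v, so everything reduces to a weak
   maximum principle for supersolutions with zero-order coefficient c >= 0. Applied
   to v and to the time shifts v(x, t + h) - v(x, t), it shows that v is
   nondecreasing in t as soon as its right-hand side is nonnegative and
   nondecreasing in t, without differentiating the equation or the boundary
   condition. The sign of the time derivative at t = T then compares c, c^k and
   c^(k+1), and an induction on k concludes.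

   The maximum principle on the polygon is local. At a negative minimum (x0, t0) of
   V = v + eps t, add a small multiple of
     |x - x0|^2 + (t - t0)^2 - a q.(x - x0) - b |x - x0|^(1/2)
   where q.nu < 0 for the normals nu of the (one or two) edges through x0. The
   radial terms have no normal derivative on these edges, so the linear term makes
   the Robin condition strict there; the square root excludes the centre x0, hence
   also the vertices, where no boundary condition is available; and in the interior
   -div(kap grad) of the square root term is of order |x - x0|^(-3/2) with the good
   sign. *)

Require Import Defs.
From HB Require Import structures.
From mathcomp Require Import all_boot all_order all_algebra.
From mathcomp Require Import all_classical all_reals all_analysis.
From mathcomp Require Import ring lra zify.

Set Implicit Arguments.
Unset Strict Implicit.
Unset Printing Implicit Defensive.

Import Order.TTheory GRing.Theory Num.Theory.
Import numFieldNormedType.Exports.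
Local Open Scope classical_set_scope.
Local Open Scope ring_scope.

(** * Derivatives along lines and the second-order test at a minimum *)

Lemma is_derive_line (R : realType) (V : normedModType R) (g : V -> R)
    (x v : V) (s : R) :
  derivable g (x + s *: v) v ->
  is_derive s 1 (fun r => g (x + r *: v)) ('D_v g (x + s *: v)).
Proof.
have E : (fun h : R => h^-1 *: (((fun r => g (x + r *: v)) \o shift s) (h *: 1)
            - g (x + s *: v)))
       = (fun h => h^-1 *: ((g \o shift (x + s *: v)) (h *: v)
            - g (x + s *: v))).
  apply/funext => h /=; congr (_ *: (g _ - _)).
  by rewrite [_%:A]mulr1 scalerDl addrCA addrA addrC !addrA.
by move=> dg; split; rewrite /derivable /derive E.
Qed.

(** A negative second derivative would make [phi'] negative just to the right of the critical point
    0, and the mean value theorem would then produce a value below [phi 0]. The second derivative is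
    thus required at 0 only. *)
Lemma second_derivative_min (R : realType) (phi : R -> R) (d : R) :
  0 < d -> (forall s, `|s| < d -> derivable phi s 1) ->
  (forall s, `|s| < d -> phi 0 <= phi s) ->
  derivable ('D_1 phi) 0 1 ->
  'D_1 phi 0 = 0 /\ 0 <= 'D_1 ('D_1 phi) 0.
Proof.
move=> d0 dphi phimin ddphi.
have inD s : s \in `](- d), d[ -> `|s| < d.
  by rewrite in_itv /= -ltr_norml.
have phi'0 : 'D_1 phi 0 = 0.
  suff : is_derive (0 : R) 1 phi 0 by move=> /@derive_val.
  apply: (@derive1_at_min _ _ (- d) d).
  - by rewrite ge0_cp // ltW.
  - by move=> t /inD; exact: dphi.
  - by rewrite in_itv /= oppr_lt0 d0.
  - by move=> t /inD; exact: phimin.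
split=> //; rewrite leNgt; apply/negP => phi''0.
have /(cvgr_lt ('D_1 ('D_1 phi) 0)) /(_ _ phi''0) : derivable ('D_1 phi) 0 1.
  exact: ddphi.
move=> [e /= e0 phi'lt0].
pose h := Num.min e d / 2.
have ed0 : 0 < Num.min e d by rewrite lt_min e0.
have h0 : 0 < h by rewrite divr_gt0.
have hed : h < Num.min e d by rewrite ltr_pdivrMr // ltr_pMr // ltr1n.
have hd : h < d by apply: lt_le_trans hed _; rewrite ge_min lexx orbT.
have he : h < e by apply: lt_le_trans hed _; rewrite ge_min lexx.
have [||c] := @MVT _ phi ('D_1 phi) 0 h h0.
- move=> x; rewrite in_itv /= => /andP[x0 xh]; apply/derivableP/dphi.
  by rewrite gtr0_norm // (lt_trans xh).
- apply: derivable_within_continuous => x; rewrite in_itv /= => /andP[x0 xh].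
  by apply: dphi; rewrite ger0_norm // (le_lt_trans xh).
rewrite in_itv /= => /andP[c0 ch].
have := phi'lt0 c; rewrite /= sub0r normrN gtr0_norm // (lt_trans ch) //.
rewrite gt_eqF // => /(_ isT isT).
rewrite phi'0 subr0 addr0 [_%:A]mulr1 /GRing.scale /= pmulr_rlt0 ?invr_gt0 //.
move=> phi'c phih; have := phimin h; rewrite gtr0_norm // => /(_ hd).
by rewrite -subr_ge0 phih subr0 pmulr_lge0 // leNgt phi'c.
Qed.

Lemma near_ball (R : realType) (V : normedModType R) (x : V) (P : V -> Prop) :
  (\forall y \near x, P y) ->
  exists2 e : R, 0 < e & forall y, `|y - x| < e -> P y.
Proof.
move=> /nbhs_ballP[e /= e0 xeP]; exists e => // y yx.
by apply: xeP; rewrite -ball_normE /= distrC.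
Qed.

Lemma derive2_min (R : realType) (V : normedModType R) (W : V -> R) (x e : V) :
  (\forall y \near x, W x <= W y /\ derivable W y e) ->
  derivable ('D_e W) x e ->
  'D_e W x = 0 /\ 0 <= 'D_e ('D_e W) x.
Proof.
move=> /near_ball[r r0 xr] ddW.
pose phi s := W (x + s *: e).
pose d := r / (`|e| + 1).
have e1 : 0 < `|e| + 1 by rewrite ltr_wpDl.
have d0 : 0 < d by rewrite divr_gt0.
have inr (s : R) : `|s| < d -> `|(x + s *: e) - x| < r.
  rewrite addrC addKr normrZ ltr_pdivlMr // => sd; apply: le_lt_trans sd.
  by rewrite ler_wpM2l // lerDl.
have dphi (s : R) : `|s| < d -> is_derive s 1 phi ('D_e W (x + s *: e)).
  by move=> sd; apply: is_derive_line; apply: (xr _ _).2; exact: inr.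
have D1 : \forall s \near (0 : R), 'D_e W (x + s *: e) = 'D_1 phi s.
  exists d => //= s /=; rewrite sub0r normrN => sd.
  by have /@derive_val := dphi _ sd.
have D2' := @is_derive_line _ _ ('D_e W) x e 0.
rewrite scale0r addr0 in D2'.
have D2 := near_eq_is_derive D1 (D2' ddW).
have := @second_derivative_min _ phi d d0.
rewrite -(nbhs_singleton D1) (@derive_val _ _ _ _ _ _ _ D2) scale0r addr0; apply.
- by move=> s sd; have [] := dphi s sd.
- by move=> s /inr/xr[]; rewrite /phi scale0r addr0.
- exact: ex_derive.
Qed.

Lemma increment_approx (R : realType) (phi dphi : R -> R) (L e h : R) :
  (forall s : R, `|s| <= `|h| -> is_derive s 1 phi (dphi s) /\ `|dphi s - L| <= e) ->
  `|phi h - phi 0 - h * L| <= e * `|h|.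
Proof.
move=> H.
have cont (a b : R) : `|a| <= `|h| -> `|b| <= `|h| -> {within `[a, b], continuous phi}.
  move=> ah bh; apply: derivable_within_continuous => x.
  rewrite in_itv /= => /andP[ax xb]; apply: ex_derive; apply: (H _ _).1.
  case: (lerP 0 x) => x0.
    by rewrite (le_trans _ bh)// !ger0_norm // (le_trans x0).
  have a0 := le_lt_trans ax x0.
  by rewrite (le_trans _ ah)// !ltr0_norm // lerN2.
have [h0|h0|->] := ltgtP h 0; last by rewrite subrr mul0r subr0 normr0 mulr0.
- have [||c] := @MVT _ phi dphi h 0 h0.
  + move=> x; rewrite in_itv /= => /andP[hx x0]; apply: (H _ _).1.
    by rewrite !ltr0_norm // lerN2 ltW.
  + by apply: cont => //; rewrite normr0.
  rewrite in_itv /= => /andP[hc c0] E.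
  have -> : phi h - phi 0 - h * L = (dphi c - L) * h by lra.
  rewrite normrM ler_wpM2r //; apply: (H _ _).2.
  by rewrite !ltr0_norm // lerN2 ltW.
- have [||c] := @MVT _ phi dphi 0 h h0.
  + move=> x; rewrite in_itv /= => /andP[x0 hx]; apply: (H _ _).1.
    by rewrite !gtr0_norm // ltW.
  + by apply: cont => //; rewrite normr0.
  rewrite in_itv /= => /andP[c0 hc] E.
  have -> : phi h - phi 0 - h * L = (dphi c - L) * h by lra.
  rewrite normrM ler_wpM2r //; apply: (H _ _).2.
  by rewrite !gtr0_norm // ltW.
Qed.

(** * Coordinates of the plane; directional derivatives from partial ones *)

Lemma rV2_coord_le (R : realType) (x : 'rV[R]_2) (i : 'I_2) : `|x 0 i| <= `|x|.
Proof.
rewrite {2}/Num.norm /= mx_normrE.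
exact: (le_bigmax 0 (fun ij : 'I_1 * 'I_2 => `|x ij.1 ij.2|) (0, i)).
Qed.

Lemma ord2_ind (P : 'I_2 -> Prop) : P 0 -> P 1 -> forall i, P i.
Proof.
move=> P0 P1 [[|[|//]] i].
  by rewrite (_ : Ordinal i = 0) //; exact/val_inj.
by rewrite (_ : Ordinal i = 1) //; exact/val_inj.
Qed.

Lemma rV2_norm_le (R : realType) (x : 'rV[R]_2) (r : R) :
  (`|x| <= r) = (`|x 0 0| <= r) && (`|x 0 1| <= r).
Proof.
apply/idP/andP => [xr|[x0 x1]].
  by split; apply: le_trans xr; exact: rV2_coord_le.
rewrite /Num.norm /= mx_normrE.
apply/bigmax_leP; split=> [|[i j] _ /=]; first exact: le_trans x0.
by rewrite (ord1 i); elim/ord2_ind: j.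
Qed.

Lemma rV2_sum (R : realType) (x : 'rV[R]_2) : x = x 0 0 *: ei 0 + x 0 1 *: ei 1.
Proof.
by apply/rowP; apply: ord2_ind; rewrite !mxE /= ?mulr1 ?mulr0 ?addr0 ?add0r.
Qed.

Lemma ei_norm_le1 (R : realType) (i : 'I_2) : `|ei i : 'rV[R]_2| <= 1.
Proof.
by rewrite rV2_norm_le !mxE; apply/andP; split; rewrite normr_nat -[leRHS]/1%:R ler_nat leq_b1.
Qed.

(** The path from [x] to [x + h d] is replaced by two legs parallel to the axes, and
    [increment_approx] is applied to each. Regularity is stated through partial derivatives, whereas
    rays and edge normals point in arbitrary directions. *)
Lemma is_derive_partials (R : realType) (g : 'rV[R]_2 -> R) (x d : 'rV[R]_2) :
  (\forall y \near x, forall i, derivable g y (ei i)) ->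
  (forall i, {for x, continuous ('D_(ei i) g)}) ->
  is_derive x d g (d 0 0 * 'D_(ei 0) g x + d 0 1 * 'D_(ei 1) g x).
Proof.
move=> dg cg; set L0 := 'D_(ei 0) g x; set L1 := 'D_(ei 1) g x.
suff Q : h^-1 *: ((g \o shift x) (h *: d) - g x) @[h --> 0^'] -->
    (d 0 0 * L0 + d 0 1 * L1).
  by split; [apply/cvg_ex; exists (d 0 0 * L0 + d 0 1 * L1)|exact: cvg_lim Q].
apply/cvgrPdist_le => e e0.
(* [|h| * M] bounds the distance from [x] to every point of the two legs, and [M] also dominates the
   sum of the two relative errors; hence the radius [r / M] and the tolerance [e / M]. *)
pose M := `|d 0 0| + `|d 0 1| + 1.
have M0 : 0 < M by rewrite /M ltr_wpDl // addr_ge0.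
pose e' := e / M; have e'0 : 0 < e' by rewrite divr_gt0.
have : \forall y \near x, (forall i, derivable g y (ei i)) /\
    (forall i, `|'D_(ei i) g y - 'D_(ei i) g x| <= e').
  have /cvgrPdist_le /(_ e' e'0) n0 := cg 0.
  have /cvgrPdist_le /(_ e' e'0) n1 := cg 1.
  apply: filterS3 dg n0 n1 => y dgy n0 n1; split=> //.
  by apply: ord2_ind; rewrite distrC; [exact: n0|exact: n1].
move=> /near_ball[r r0 xr].
exists (r / M) => /=; first by rewrite divr_gt0.
move=> h /=; rewrite sub0r normrN => hr h0.
have {}hr : `|h| * M < r by rewrite -ltr_pdivlMr.
have near_x (s t : R) : `|s| <= `|h * d 0 0| -> `|t| <= `|h * d 0 1| ->
    `|x + s *: ei 0 + t *: ei 1 - x| < r.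
  rewrite !normrM => sh th; rewrite -[x + _ + _]addrA (addrC x) addrK.
  apply: le_lt_trans (ler_normD _ _) _; rewrite !normrZ.
  apply: le_lt_trans hr; rewrite addrC mulrDr mulr1 mulrDr.
  have /= := ei_norm_le1 R 0; have /= := ei_norm_le1 R 1.
  have /= := normr_ge0 (ei 0 : 'rV[R]_2); have /= := normr_ge0 (ei 1 : 'rV[R]_2).
  have := normr_ge0 h; have := normr_ge0 s; have := normr_ge0 t.
  nra.
have A0 : `|g (x + (h * d 0 0) *: ei 0) - g x - h * d 0 0 * L0| <= e' * `|h * d 0 0|.
  have := @increment_approx _ (fun s => g (x + s *: ei 0))
    (fun s => 'D_(ei 0) g (x + s *: ei 0)) L0 e' (h * d 0 0).
  rewrite scale0r addr0; apply=> s sh.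
  have := near_x s 0 sh; rewrite normr0 => /(_ (normr_ge0 _)).
  rewrite scale0r addr0 => /xr[d1 d2]; split; last exact: d2.
  exact: is_derive_line.
pose z := x + (h * d 0 0) *: ei 0.
have A1 : `|g (z + (h * d 0 1) *: ei 1) - g z - h * d 0 1 * L1| <= e' * `|h * d 0 1|.
  have := @increment_approx _ (fun s => g (z + s *: ei 1))
    (fun s => 'D_(ei 1) g (z + s *: ei 1)) L1 e' (h * d 0 1).
  rewrite scale0r addr0; apply=> s sh.
  have := near_x (h * d 0 0) s (lexx _) sh.
  move=> /xr[d1 d2]; split; last exact: d2.
  exact: is_derive_line.
have E : z + (h * d 0 1) *: ei 1 = h *: d + x.
  by rewrite [in RHS](rV2_sum d) scalerDr !scalerA /z -addrA addrC.
have -> : d 0 0 * L0 + d 0 1 * L1 - h^-1 *: ((g \o shift x) (h *: d) - g x) =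
  - h^-1 * ((g z - g x - h * d 0 0 * L0) + (g (z + (h * d 0 1) *: ei 1) - g z - h * d 0 1 * L1)).
  rewrite E /= /GRing.scale /=.
  by field.
rewrite normrM normrN normrV ?unitfE //.
rewrite mulrC ler_pdivrMr ?normr_gt0 //.
apply: le_trans (ler_normD _ _) _.
apply: le_trans (lerD A0 A1) _.
rewrite !normrM -mulrDr -mulrDr mulrCA [e * _]mulrC ler_wpM2l //.
by rewrite /e' mulrAC ler_pdivrMr // ler_wpM2l // ?lerDl // ltW.
Qed.

(** * Behaviour up to the boundary: rays and normal derivatives *)

Lemma within_closure_nbhs (R : realType) (U : normedModType R) (Omega : set U)
    (g : U -> R) (x : U) :
  open Omega -> Omega x -> {within closure Omega, continuous g} ->
  {for x, continuous g}.
Proof.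
move=> oO Ox /subspace_continuousP /(_ x (subset_closure Ox)) gx.
apply: cvg_trans gx; apply: cvg_app => P wP; change (\forall y \near x, P y).
have {}wP : \forall y \near x, closure Omega y -> P y by exact: wP.
have nO : \forall y \near x, Omega y by exact: open_nbhs_nbhs.
by apply: filterS2 wP nO => y + Oy; apply; exact: subset_closure.
Qed.

Lemma cont_ext_at (R : realType) (Omega : set 'rV[R]_2) (g : 'rV[R]_2 -> R)
    (x : 'rV[R]_2) :
  open Omega -> Omega x -> cont_ext Omega (closure Omega) g ->
  {for x, continuous g}.
Proof.
move=> oO Ox [G [cG gG]].
have Gx : G y @[y --> x] --> G x by exact: within_closure_nbhs cG.
have nO : \forall y \near x, Omega y by exact: open_nbhs_nbhs.
have gx : g y @[y --> x] --> G x.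
  apply: cvg_trans Gx; apply: (@near_eq_cvg _ _ (nbhs (x : 'rV[R]_2))).
  by near=> y; rewrite gG // inE; near: y; exact: nO.
by rewrite -gG ?inE // in gx.
Unshelve. all: by end_near. Qed.

Lemma cvg_ray (R : realType) (Omega : set 'rV[R]_2) (g : 'rV[R]_2 -> R)
    (x d : 'rV[R]_2) :
  closure Omega x -> (\forall s \near 0^'+, Omega (x + s *: d)) ->
  {within closure Omega, continuous g} ->
  g (x + s *: d) @[s --> 0^'+] --> g x.
Proof.
move=> cx sO /subspace_continuousP /(_ x cx) gx.
apply: cvg_comp; last exact: gx.
move=> P xP; have {xP} /near_ball[e e0 xP] :
  \forall y \near x, closure Omega y -> P y by exact: xP.
change (\forall s \near 0^'+, P (x + s *: d)).
near=> s; apply: xP; last by apply: subset_closure; near: s.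
rewrite addrC addKr normrZ.
have d1 : 0 < `|d| + 1 by rewrite ltr_wpDl.
have s0 : 0 < s by near: s; exact: nbhs_right_gt.
have se : s < e / (`|d| + 1) by near: s; apply: nbhs_right_lt; rewrite divr_gt0.
rewrite gtr0_norm //; move: se; rewrite ltr_pdivlMr //; apply: le_lt_trans.
by rewrite ler_wpM2l ?lerDl // ltW.
Unshelve. all: by end_near. Qed.

(** At a boundary point the partial derivatives exist only through their continuous extensions.
    Along the ray the derivative at interior points tends to the value built from these extensions,
    and l'Hospital's rule transfers this limit to the difference quotient. *)
Lemma ray_quotient_cvg (R : realType) (Omega : set 'rV[R]_2)
    (g : 'rV[R]_2 -> R) (x d : 'rV[R]_2) :
  open Omega -> closure Omega x -> (\forall s \near 0^'+, Omega (x + s *: d)) ->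
  C1_space Omega g ->
  cvg ((g (x + s *: d) - g x) / s @[s --> 0^'+]).
Proof.
move=> oO cx sO [cg dg Dg].
have [G0 [cG0 gG0]] := Dg 0; have [G1 [cG1 gG1]] := Dg 1.
pose L := d 0 0 * G0 x + d 0 1 * G1 x.
apply/cvg_ex; exists L.
case: (sO) => e /= e0 eO.
have inO (s : R) : 0 < s -> s < e -> Omega (x + s *: d).
  by move=> s0 se; apply: eO => //=; rewrite sub0r normrN gtr0_norm.
pose df s := d 0 0 * 'D_(ei 0) g (x + s *: d) + d 0 1 * 'D_(ei 1) g (x + s *: d).
apply: (@lhopital_at_right _ (fun s => g (x + s *: d) - g x) df id (cst 1) 0 e) => //.
- move=> s; rewrite in_itv /= => /andP[s0 se].
  have Os := inO s s0 se.
  have D : is_derive (x + s *: d) d g (df s).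
    apply: is_derive_partials.
      have nO : \forall y \near x + s *: d, Omega y by exact: open_nbhs_nbhs.
      by apply: filterS nO => y Oy i; exact: dg.
    by move=> i; exact: cont_ext_at (Dg i).
  rewrite -[df s]subr0; apply: is_deriveB.
  rewrite -(@derive_val _ _ _ _ _ _ _ D).
  by apply: is_derive_line; exact: ex_derive.
- rewrite -[X in _ --> X](subrr (g x)); apply: cvgB; last exact: cvg_cst.
  exact: (cvg_ray cx sO cg).
- exact: cvg_at_right_filter.
- by move=> *; exact: oner_neq0.
- have c0 := cvg_ray cx sO cG0; have c1 := cvg_ray cx sO cG1.
  have : d 0 0 * G0 (x + s *: d) + d 0 1 * G1 (x + s *: d) @[s --> 0^'+] --> L.
    by apply: cvgD; apply: cvgM => //; exact: cvg_cst.
  apply: cvg_trans; apply: near_eq_cvg; near=> s.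
  have Os : Omega (x + s *: d) by near: s.
  by rewrite /df divr1 gG0 ?gG1 ?inE.
Unshelve. all: by end_near. Qed.

(** [normal_deriv] is a [lim], which carries information only once the quotients are known to
    converge. *)
Lemma normal_deriv_cvg (R : realType) (Omega : set 'rV[R]_2)
    (g : 'rV[R]_2 -> R) (x nu : 'rV[R]_2) :
  open Omega -> closure Omega x -> (\forall s \near 0^'+, Omega (x - s *: nu)) ->
  C1_space Omega g ->
  (g x - g (x - s *: nu)) / s @[s --> 0^'+] --> normal_deriv nu g x.
Proof.
move=> oO cx sO Cg.
have sO' : \forall s \near 0^'+, Omega (x + s *: - nu).
  by apply: filterS sO => s; rewrite scalerN.
have /cvgN := ray_quotient_cvg oO cx sO' Cg.
set F := (X in X @ _ --> _).
have -> : F = fun s => (g x - g (x - s *: nu)) / s.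
  by apply/funext => s; rewrite /F fctE -mulNr opprB scalerN.
by move=> /cvgP.
Qed.

(** * Euclidean geometry of the edges of a simple polygon *)

Definition dotp (R : realType) (x y : 'rV[R]_2) : R :=
  x 0 0 * y 0 0 + x 0 1 * y 0 1.

Lemma dotpDl (R : realType) (x y z : 'rV[R]_2) :
  dotp (x + y) z = dotp x z + dotp y z.
Proof. by rewrite /dotp !mxE; ring. Qed.

Lemma dotpZl (R : realType) (a : R) (x z : 'rV[R]_2) :
  dotp (a *: x) z = a * dotp x z.
Proof. by rewrite /dotp !mxE; ring. Qed.

Lemma dotpC (R : realType) (x z : 'rV[R]_2) : dotp x z = dotp z x.
Proof. by rewrite /dotp; ring. Qed.

Lemma dotpDr (R : realType) (x y z : 'rV[R]_2) :
  dotp z (x + y) = dotp z x + dotp z y.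
Proof. by rewrite /dotp !mxE; ring. Qed.

Lemma dotpZr (R : realType) (a : R) (x z : 'rV[R]_2) :
  dotp z (a *: x) = a * dotp z x.
Proof. by rewrite /dotp !mxE; ring. Qed.

Lemma dotp_ge0 (R : realType) (x : 'rV[R]_2) : 0 <= dotp x x.
Proof. by rewrite /dotp -!expr2 addr_ge0 // sqr_ge0. Qed.

Lemma dotp_eq0 (R : realType) (x : 'rV[R]_2) : (dotp x x == 0) = (x == 0).
Proof.
apply/idP/eqP => [|->]; last by rewrite /dotp !mxE !mul0r addr0.
rewrite /dotp -!expr2 paddr_eq0 ?sqr_ge0 // !sqrf_eq0 => /andP[/eqP x0 /eqP x1].
by rewrite (rV2_sum x) x0 x1 !scale0r addr0.
Qed.

Section Edges.
Context {R : realType} {n : nat} (p : 'I_n -> 'rV[R]_2).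

Definition edge_dir (i : 'I_n) := p (ordS i) - p i.

Lemma edge_ptE (i : 'I_n) (s : R) : edge_pt p i s = p i + s *: edge_dir i.
Proof. by rewrite /edge_pt /edge_dir; apply/rowP => j; rewrite !mxE; ring. Qed.

Lemma edge_pt0 (i : 'I_n) : edge_pt p i 0 = p i.
Proof. by rewrite edge_ptE scale0r addr0. Qed.

Lemma edge_pt1 (i : 'I_n) : edge_pt p i 1 = p (ordS i).
Proof. by rewrite edge_ptE scale1r /edge_dir addrC subrK. Qed.

Lemma edge_normal_orth (i : 'I_n) : dotp (edge_dir i) (edge_normal p i) = 0.
Proof. by rewrite /dotp /edge_normal /edge_dir !mxE /=; ring. Qed.

Lemma edge_normalE (i : 'I_n) (j : 'I_2) : edge_normal p i 0 j =
  (Num.sqrt (dotp (edge_dir i) (edge_dir i)))^-1 *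
    (if j == 0 then edge_dir i 0 1 else - edge_dir i 0 0).
Proof. by rewrite /edge_normal /dotp -!expr2 !mxE. Qed.

Lemma edge_normal_unit (i : 'I_n) : edge_dir i != 0 ->
  dotp (edge_normal p i) (edge_normal p i) = 1.
Proof.
move=> d0; rewrite {1}/dotp !edge_normalE /=.
set S := dotp _ _.
have S0 : 0 < S by rewrite lt_def dotp_ge0 dotp_eq0 d0.
have sS : Num.sqrt S != 0 by rewrite sqrtr_eq0 -ltNge.
have kS : (Num.sqrt S)^-1 ^+ 2 * S = 1.
  by rewrite -{2}(sqr_sqrtr (ltW S0)) -exprMn mulVf // expr1n.
by rewrite -[RHS]kS; move: (_^-1) => k; rewrite /S /dotp; ring.
Qed.

Lemma closed_edge_closed (i : 'I_n) : closed (closed_edge p i).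
Proof.
apply: compact_closed; first exact: norm_hausdorff.
apply: continuous_compact; last exact: segment_compact.
apply: continuous_subspaceT => s.
rewrite (_ : edge_pt p i = fun s => p i + s *: edge_dir i); last first.
  by apply/funext => t; exact: edge_ptE.
apply: cvgD; first exact: cvg_cst.
by apply: cvgZr_tmp.
Qed.

End Edges.

(** Off the boundary, membership in [Omega] and in its closure coincide, so [S] meets [Omega] in a
    relatively open and closed set. *)
Lemma connected_subset (T : topologicalType) (S Omega : set T) (y : T) :
  connected S -> open Omega -> (forall x, S x -> ~ bnd Omega x) ->
  S y -> Omega y -> S `<=` Omega.
Proof.
move=> cS oO Sb Sy Oy; suff <- : S `&` Omega = S by move=> x [].
apply: cS; first by exists y.
- by exists Omega.
- exists (closure Omega); first exact: closed_closure.
  apply/seteqP; split=> x [Sx Ox]; split=> //; first exact: subset_closure.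
  by apply: contrapT => nOx; apply: (Sb x Sx); split=> // /interior_subset.
Qed.

Section PolygonLocal.
Context {R : realType} {n : nat} {p : 'I_n -> 'rV[R]_2}.
Hypothesis simple : forall i j s t, s \in `[0, 1[ -> t \in `[0, 1[ ->
  edge_pt p i s = edge_pt p j t -> i = j /\ s = t.

Let half_itv : (2^-1 : R) \in `[0, 1[.
Proof. by rewrite in_itv /=; lra. Qed.

Let zero_itv : (0 : R) \in `[0, 1[.
Proof. by rewrite in_itv /= lexx ltr01. Qed.

Lemma edge_dir_neq0 (i : 'I_n) : edge_dir p i != 0.
Proof.
apply/eqP => d0; have [] := simple (i := i) (j := i) zero_itv half_itv.
  by rewrite !edge_ptE d0 !scaler0.
by move=> _; lra.
Qed.

Lemma ordS_neq (i : 'I_n) : (3 <= n)%N -> ordS i != i.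
Proof.
move=> n3; apply/eqP => /(congr1 val) /=; have := ltn_ord i.
by rewrite leq_eqVlt => /orP[/eqP E|?]; rewrite ?E ?modnn ?modn_small //; lia.
Qed.

(** For unit normals the value -1 forces opposite vectors; the two edges would then leave their
    common vertex in the same direction and overlap, against simplicity. *)
Lemma adjacent_normals (i : 'I_n) : (3 <= n)%N ->
  -1 < dotp (edge_normal p (ordS i)) (edge_normal p i).
Proof.
move=> n3; set j := ordS i.
set a := edge_normal p j; set b := edge_normal p i.
rewrite ltNge; apply/negP => ab.
have aa : dotp a a = 1 by exact/edge_normal_unit/edge_dir_neq0.
have bb : dotp b b = 1 by exact/edge_normal_unit/edge_dir_neq0.
have : dotp (a + b) (a + b) <= 0.
  by rewrite dotpDl !dotpDr aa bb (dotpC b a); lra.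
rewrite -[_ <= 0]andbT -(dotp_ge0 (a + b)) -eq_le dotp_eq0 => /eqP ab0.
pose la := Num.sqrt (dotp (edge_dir p j) (edge_dir p j)).
pose lb := Num.sqrt (dotp (edge_dir p i) (edge_dir p i)).
have pos (k : 'I_n) : 0 < Num.sqrt (dotp (edge_dir p k) (edge_dir p k)).
  by rewrite sqrtr_gt0 lt_def dotp_ge0 dotp_eq0 edge_dir_neq0.
have la0 : 0 < la by exact: pos.
have lb0 : 0 < lb by exact: pos.
have dE : la^-1 *: edge_dir p j = - (lb^-1 *: edge_dir p i).
  have /rowP E := ab0; have := E 0; have := E 1.
  rewrite [LHS]mxE [RHS]mxE => E1; rewrite [LHS]mxE [RHS]mxE => E0; move: E1 E0.
  rewrite /a /b !edge_normalE /= -/la -/lb => E1 E0.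
  by apply/rowP; apply: ord2_ind; rewrite [LHS]mxE [RHS]mxE [X in - X]mxE; lra.
(* The point at distance [m] from the common vertex lies on both overlapping edges; halving the
   shorter length keeps both parameters in [[0, 1[]. *)
pose m := Num.min la lb / 2.
have min0 : 0 < Num.min la lb by rewrite lt_min la0.
have m0 : 0 < m by rewrite divr_gt0.
have mla : m < la.
  by apply: (@lt_le_trans _ _ (Num.min la lb)); rewrite ?ge_min ?lexx // /m; lra.
have mlb : m < lb.
  apply: (@lt_le_trans _ _ (Num.min la lb)); rewrite ?ge_min ?lexx ?orbT //.
  by rewrite /m; lra.
have [|||] := simple (i := j) (j := i) (s := m / la) (t := 1 - m / lb).
- rewrite in_itv /= divr_ge0 ?(ltW m0) ?(ltW la0) //=.
  by rewrite ltr_pdivrMr // mul1r.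
- rewrite in_itv /= subr_ge0 ler_pdivrMr // mul1r (ltW mlb) /=.
  by rewrite ltrBlDr ltrDl divr_gt0.
- rewrite !edge_ptE -[m / la *: _]scalerA dE scalerN scalerA.
  have -> : p j = p i + edge_dir p i by rewrite /edge_dir addrC subrK.
  by rewrite scalerBl scale1r [RHS]addrA.
by move=> ji _; have := ordS_neq i n3; rewrite -[ordS i]/j ji eqxx.
Qed.

(** Inside an edge, minus its normal works. At a vertex exactly two edges meet, and minus the sum of
    their normals works: its product with either one is [- (1 + dotp a b)], negative by
    [adjacent_normals]. *)
Lemma inward_vector (x : 'rV[R]_2) : (3 <= n)%N ->
  exists q, forall i, closed_edge p i x -> dotp q (edge_normal p i) < 0.
Proof.
move=> n3.
have unit i := edge_normal_unit (edge_dir_neq0 i).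
have [[i xi]|xN] := pselect (exists i, closed_edge p i x); last first.
  by exists 0 => i xi; case: xN; exists i.
(* The end of an edge is rewritten as the start of the next one, so that the half-open
   parametrisation, where [simple] applies, covers vertices too. *)
have {xi i} [i [s s01 xE]] : exists i, exists2 s, s \in `[0, 1[ & edge_pt p i s = x.
  case: xi => s /=; rewrite in_itv /= => /andP[s0]; rewrite le_eqVlt.
  case/orP=> [/eqP ->|s1] <-; first by exists (ordS i), 0; rewrite ?edge_pt0 ?edge_pt1.
  by exists i, s => //; rewrite in_itv /= s0.
have through j : closed_edge p j x -> j = i \/ (s = 0 /\ ordS j = i).
  case=> t /=; rewrite in_itv /= => /andP[t0]; rewrite le_eqVlt.
  case/orP=> [/eqP ->|t1] xj.
    right; have [] := simple (i := ordS j) (j := i) zero_itv s01.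
      by rewrite edge_pt0 -edge_pt1 xj.
    by move=> -> <-.
  left; have [] := simple (i := j) (j := i) (s := t) (t := s) => //.
    by rewrite in_itv /= t0.
  by rewrite xj.
have [s0|sN0] := eqVneq s 0; last first.
  exists (- edge_normal p i) => j /through[->|[/eqP]]; last by rewrite (negPf sN0).
  by rewrite -scaleN1r dotpZl unit mulr1 ltrN10.
exists (- (edge_normal p i + edge_normal p (ord_pred i))) => j /through jE.
have := adjacent_normals (ord_pred i) n3; rewrite ord_predK => ij.
rewrite -scaleN1r dotpZl dotpDl.
case: jE => [->|[_ jE]].
  by rewrite unit (dotpC _ (edge_normal p i)); lra.
by rewrite -jE ordSK jE in ij *; rewrite unit; lra.
Qed.

End PolygonLocal.

(** * Shape of the polygon near a given point *)

Lemma open_not_bnd (T : topologicalType) (Omega : set T) (x : T) :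
  open Omega -> Omega x -> ~ bnd Omega x.
Proof. by move=> /interior_id oO Ox [_]; rewrite oO. Qed.

Section PolygonNear.
Context {R : realType} {n : nat} {p : 'I_n -> 'rV[R]_2} {Omega : set 'rV[R]_2}.
Hypothesis polyO : polygon p Omega.

Let n_ge3 : (3 <= n)%N. Proof. by case: polyO => -[]. Qed.

Let openO : open Omega. Proof. by case: polyO => _ []. Qed.

Let bndE : bnd Omega = \bigcup_i closed_edge p i.
Proof. by case: polyO. Qed.

Lemma open_edge_bnd (i : 'I_n) (x : 'rV[R]_2) : open_edge p i x -> bnd Omega x.
Proof.
rewrite bndE => -[s /=]; rewrite in_itv /= => /andP[s0 s1] <-; exists i => //.
by exists s => //=; rewrite in_itv /= !ltW.
Qed.

(** Edges and vertices are finitely many closed sets, so those that miss [x0] also miss a whole ball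
    around it. *)
Lemma edges_near (x0 : 'rV[R]_2) : exists2 rho : R, 0 < rho &
  forall i x, `|x - x0| < rho -> (closed_edge p i x -> closed_edge p i x0) /\
    (x = p i -> x0 = p i).
Proof.
pose P i x := (closed_edge p i x -> closed_edge p i x0) /\ (x = p i -> x0 = p i).
have nP : \forall x \near x0, forall i, P i x.
  apply: (@filter_forall _ _ P (nbhs x0)) => i.
  have A : \forall x \near x0, closed_edge p i x -> closed_edge p i x0.
    have [?|xi] := pselect (closed_edge p i x0); first by near=> x.
    have : open_nbhs x0 (~` closed_edge p i).
      by split=> //; apply: closed_openC; exact: closed_edge_closed.
    move=> /open_nbhs_nbhs nQ; near=> x => ?; exfalso.
    by suff: (~` closed_edge p i) x by []; near: x; exact: nQ.
  have B : \forall x \near x0, x = p i -> x0 = p i.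
    have [->|/eqP xi] := eqVneq x0 (p i); first by near=> x.
    have : open_nbhs x0 (~` [set p i]).
      split=> //; apply: closed_openC; apply: accessible_closed_set1.
      exact/hausdorff_accessible/norm_hausdorff.
    move=> /open_nbhs_nbhs nQ; near=> x => ?; exfalso.
    by suff: (~` [set p i]) x by []; near: x; exact: nQ.
  by near=> x; split; near: x; [exact: A|exact: B].
have [rho rho0 H] := near_ball nP; exists rho => // i x xx0. exact: (H x xx0 i).
Unshelve. all: by end_near. Qed.

(** In the ball of [edges_near] an edge carrying [x] also carries [x0], and the only possible vertex
    is [x0] itself, so [x] is interior to that edge. The two parameters record that [x - x0] is
    tangent to it. *)
Lemma bnd_near (x0 : 'rV[R]_2) : exists2 rho : R, 0 < rho &
  (forall i x, `|x - x0| < rho -> x = p i -> x0 = p i) /\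
  forall x, bnd Omega x -> `|x - x0| < rho -> x != x0 ->
    exists i, [/\ open_edge p i x, closed_edge p i x0 &
      exists t s, [/\ 0 < t < 1, 0 <= s <= 1,
        x = p i + t *: edge_dir p i & x0 = p i + s *: edge_dir p i]].
Proof.
have [rho rho0 near0] := edges_near x0; exists rho => //; split.
  by move=> i x xx0; exact: (near0 i x xx0).2.
move=> x; rewrite bndE => -[i _ xi] xx0 nx; exists i.
have x0i := (near0 i x xx0).1 xi.
have [t t01 xt] : open_edge p i x.
  case: (xi) => t /=; rewrite in_itv /= => /andP[t0 t1] xt.
  exists t => //=; rewrite in_itv /= !lt_def t0 t1 !andbT.
  apply/andP; split; apply: contraNneq nx => tE.
    by rewrite -xt tE edge_pt0 -((near0 i x xx0).2) // -xt tE edge_pt0.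
  rewrite -xt -tE edge_pt1 -((near0 (ordS i) x xx0).2) // -xt -tE.
  by rewrite edge_pt1.
split=> //; first by exists t.
case: x0i => s /=; rewrite in_itv /= => s01 x0s; exists t, s.
by move: t01 => /=; rewrite in_itv /= -!edge_ptE.
Qed.

(** This serves to approach every point of the closure, vertices included, from inside. At a
    boundary point, the segment from [x0] to a nearby point [y] of [Omega] cannot meet the boundary
    after [x0]: it would run along an edge through [x0], and [y] could be neither on this edge nor
    beyond its ends. Connectedness then keeps the segment in [Omega]. *)
Lemma interior_ray (x0 : 'rV[R]_2) : closure Omega x0 ->
  exists2 d, d != 0 & forall s : R, 0 < s <= 1 -> Omega (x0 + s *: d).
Proof.
move=> cx0; have [rho rho0 [vert edges]] := bnd_near x0.
have [Ox0|nOx0] := pselect (Omega x0).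
  have nO : \forall y \near x0, Omega y by exact: open_nbhs_nbhs.
  have [r r0 rO] := near_ball nO.
  exists ((r / 2) *: ei 0).
    rewrite scaler_eq0 mulf_eq0 invr_eq0 !negb_or gt_eqF // pnatr_eq0 /=.
    by apply/eqP => /rowP /(_ 0) /eqP; rewrite !mxE /= oner_eq0.
  move=> s /andP[s0 s1]; apply: rO; rewrite addrC addKr normrZ (normrZ (r / 2)).
  rewrite (gtr0_norm s0) gtr0_norm ?divr_gt0 //.
  have r2 : 0 < r / 2 by rewrite divr_gt0.
  apply: (@le_lt_trans _ _ (r / 2)); last by rewrite ltr_pdivrMr // ltr_pMr // ltr1n.
  apply: (@le_trans _ _ (r / 2 * `|ei 0 : 'rV[R]_2|)).
    by rewrite ler_piMl // mulr_ge0 // ltW.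
  by rewrite ler_piMr ?ei_norm_le1 // ltW.
have [y [Oy yx0]] : exists y, Omega y /\ `|y - x0| < rho.
  have [y [Oy By]] := cx0 _ (nbhsx_ballx x0 rho rho0).
  by exists y; split=> //; move: By; rewrite -ball_normE /= distrC.
have nyx0 : y != x0 by apply: contra_notN nOx0 => /eqP <-.
pose d := y - x0; have d0 : d != 0 by rewrite subr_eq0.
exists d => // s s01.
pose S := (fun t : R => x0 + t *: d) @` `]0, 1].
have Sbnd x : S x -> ~ bnd Omega x.
  move=> [t /=]; rewrite in_itv /= => /andP[t0 t1] <- bx; set z := x0 + t *: d in bx.
  have zx0 : z - x0 = t *: d by rewrite /z addrC addKr.
  have [||i [_ _ [tau [sigma [/andP[tau0 tau1] /andP[sigma0 sigma1] zE x0E]]]]] := edges z bx.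
  - rewrite zx0 normrZ gtr0_norm //; apply: le_lt_trans yx0.
    by rewrite -/d ger_pMl // normr_gt0.
  - by rewrite -subr_eq0 zx0 scaler_eq0 negb_or gt_eqF.
  (* [kappa] is the parameter of [y] on the line of the edge that contains [x0] (parameter [sigma])
     and the supposed boundary point [z] (parameter [tau]). *)
  pose D := edge_dir p i; pose kappa := sigma + (tau - sigma) / t.
  have dE : d = (kappa - sigma) *: D.
    apply: (scalerI (lt0r_neq0 t0)); rewrite -zx0 zE x0E scalerA.
    rewrite opprD addrACA subrr add0r -scalerBl; congr (_ *: _).
    by rewrite /kappa; field; rewrite gt_eqF.
  have yE : y = p i + kappa *: D.
    have -> : y = x0 + d by rewrite /d addrC subrK.
    by rewrite dE x0E -addrA -scalerDl; congr (_ + _ *: _); ring.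
  have D0 : D != 0 by apply: contra_neq d0 => D0; rewrite dE D0 scaler0.
  have nD0 : 0 < `|D| by rewrite normr_gt0.
  have kt : (kappa - sigma) * t = tau - sigma.
    by rewrite /kappa; field; rewrite gt_eqF.
  clearbody kappa.
  have dn : `|(kappa - sigma) *: D| < rho by rewrite -dE.
  move: dn; rewrite normrZ => dn.
  (* If [y] lies beyond an end of the edge, this end is closer to [x0] than [y] is, hence equals
     [x0] by the choice of [rho]; then [z], on the way to [y], would lie beyond it as well, against
     [0 < tau < 1]. *)
  have [k0|k0] := ltrP kappa 0.
    have /vert/(_ erefl) px0 : `|p i - x0| < rho.
      rewrite x0E opprD addrA subrr sub0r normrN normrZ; apply: le_lt_trans dn.
      by rewrite ler_wpM2r // ger0_norm // ltr0_norm; lra.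
    have /eqP : sigma *: D = 0 by apply: (addrI (p i)); rewrite -x0E addr0.
    by rewrite scaler_eq0 (negPf D0) orbF => /eqP; nra.
  have [k1|k1] := ltrP 1 kappa.
    have pS : p (ordS i) = p i + 1 *: D by rewrite -edge_ptE edge_pt1.
    have /vert/(_ erefl) px0 : `|p (ordS i) - x0| < rho.
      rewrite pS x0E opprD addrACA subrr add0r -scalerBl normrZ.
      apply: le_lt_trans dn.
      by rewrite ler_wpM2r // ger0_norm ?subr_ge0 // ger0_norm; lra.
    have /eqP : (1 - sigma) *: D = 0.
      by rewrite scalerBl; apply: (addrI (p i)); rewrite addrA -pS -px0 x0E addrK addr0.
    by rewrite scaler_eq0 (negPf D0) orbF => /eqP; nra.
  apply: (open_not_bnd openO Oy); rewrite bndE; exists i => //.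
  by exists kappa; rewrite /= ?in_itv /= ?k0 // edge_ptE yE.
apply: (@connected_subset _ S Omega y _ openO Sbnd).
- apply: connected_continuous_connected.
    by apply/connected_intervalP; exact: interval_is_interval.
  apply: continuous_subspaceT => t; apply: cvgD; first exact: cvg_cst.
  exact: cvgZr_tmp.
- by exists 1; rewrite /= ?in_itv /= ?ltr01 ?lexx // scale1r /d addrC subrK.
- exact: Oy.
- by exists s.
Qed.

Lemma polygon_local (x0 : 'rV[R]_2) : exists q, exists2 rho : R, 0 < rho &
  forall x, bnd Omega x -> `|x - x0| < rho -> x != x0 ->
    exists i, [/\ open_edge p i x, dotp q (edge_normal p i) < 0 &
      dotp (x - x0) (edge_normal p i) = 0].
Proof.
have simple : forall i j s t, s \in `[0, 1[ -> t \in `[0, 1[ ->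
  edge_pt p i s = edge_pt p j t -> i = j /\ s = t by case: polyO => -[].
have [q qP] := inward_vector simple x0 n_ge3.
have [rho rho0 [_ edges]] := bnd_near x0; exists q, rho => // x bx xx0 nx.
have [i [xi x0i [t [s [_ _ xE x0E]]]]] := edges x bx xx0 nx.
exists i; split=> //; first exact: qP.
by rewrite xE x0E opprD addrACA subrr add0r -scalerBl dotpZl edge_normal_orth mulr0.
Qed.

End PolygonNear.

(** * The cusp and its derivatives *)

Lemma is_derive_from_line (R : realType) (V : normedModType R) (g : V -> R)
    (x v : V) (dg : R) :
  is_derive (0 : R) 1 (fun s : R => g (x + s *: v)) dg -> is_derive x v g dg.
Proof.
have E : (fun h : R => h^-1 *: (((fun r : R => g (x + r *: v)) \o shift 0) (h *: 1)
            - g (x + 0 *: v)))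
       = (fun h => h^-1 *: ((g \o shift x) (h *: v) - g x)).
  apply/funext => h /=; congr (_ *: (g _ - g _)).
    by rewrite addr0 [_%:A]mulr1 addrC.
  by rewrite scale0r addr0.
by move=> [d1 d2]; split; [move: d1|move: d2]; rewrite /derivable /derive E.
Qed.

Lemma is_derive_sqrt_comp (R : realType) (V : normedModType R) (g : V -> R)
    (x v : V) (dg : R) :
  0 < g x -> is_derive x v g dg ->
  is_derive x v (fun y => Num.sqrt (g y)) ((2 * Num.sqrt (g x))^-1 * dg).
Proof.
move=> gx [d1 <-]; apply: is_derive_from_line.
have E : x + 0 *: v = x by rewrite scale0r addr0.
have L : is_derive (0 : R) 1 (fun s : R => g (x + s *: v)) ('D_v g x).
  by rewrite -[in 'D_v g x]E; apply: is_derive_line; rewrite E.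
apply: (@is_derive1_comp _ Num.sqrt (fun s => g (x + s *: v))).
by rewrite E; exact: is_derive1_sqrt.
Qed.

Lemma is_derive_coord (R : realType) (x x0 : 'rV[R]_2) (i j : 'I_2) :
  is_derive x (ei i) (fun y : 'rV[R]_2 => (y - x0) 0 j) (j == i)%:R.
Proof.
have Q : h^-1 *: (((fun y : 'rV[R]_2 => (y - x0) 0 j) \o shift x) (h *: ei i)
    - (x - x0) 0 j) @[h --> (0 : R)^'] --> ((j == i)%:R : R).
  apply: cvg_near_cst; exists 1 => //= h _ h0.
  rewrite /GRing.scale /= !mxE /=.
  by field.
by split; [apply/cvg_ex; exists (j == i)%:R|exact: cvg_lim Q].
Qed.

Definition sqdist (R : realType) (x0 x : 'rV[R]_2) : R := dotp (x - x0) (x - x0).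

Lemma is_derive_sqdist (R : realType) (x0 x : 'rV[R]_2) (i : 'I_2) :
  is_derive x (ei i) (sqdist x0) (2 * (x - x0) 0 i).
Proof.
have d0 := is_derive_coord x x0 i 0; have d1 := is_derive_coord x x0 i 1.
pose F j (y : 'rV[R]_2) : R := (y - x0) 0 j.
have -> : sqdist x0 = F 0 * F 0 + F 1 * F 1 by apply/funext.
apply: is_derive_eq (is_deriveD (is_deriveM d0 d0) (is_deriveM d1 d1)) _.
rewrite /GRing.scale /=.
by move: i {d0 d1}; apply: ord2_ind; rewrite /= ?mulr1 ?mulr0; ring.
Qed.

(* The Euclidean |x - x0|^(1/2): it decreases towards x0 faster than any function
   with bounded difference quotients can compensate. *)
Definition cusp (R : realType) (x0 x : 'rV[R]_2) : R :=
  Num.sqrt (Num.sqrt (sqdist x0 x)).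

Lemma sqdist_gt0 (R : realType) (x0 x : 'rV[R]_2) : x != x0 -> 0 < sqdist x0 x.
Proof. by move=> nx; rewrite lt_def dotp_ge0 dotp_eq0 subr_eq0 nx. Qed.

Lemma cusp_gt0 (R : realType) (x0 x : 'rV[R]_2) : x != x0 -> 0 < cusp x0 x.
Proof. by move=> nx; rewrite !sqrtr_gt0 sqdist_gt0. Qed.

Lemma cusp_sqr (R : realType) (x0 x : 'rV[R]_2) :
  cusp x0 x ^+ 2 = Num.sqrt (sqdist x0 x).
Proof. by rewrite sqr_sqrtr // sqrtr_ge0. Qed.

Lemma cusp_pow4 (R : realType) (x0 x : 'rV[R]_2) : cusp x0 x ^+ 4 = sqdist x0 x.
Proof. by rewrite -[4%N]/(2 * 2)%N exprM cusp_sqr sqr_sqrtr // dotp_ge0. Qed.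

(** With r the Euclidean distance to [x0], the cube of the cusp is r^(3/2) and its seventh power,
    met in the second derivative, is r^(7/2); integer powers of the cusp replace real exponents. *)
Lemma is_derive_cusp (R : realType) (x0 x : 'rV[R]_2) (i : 'I_2) : x != x0 ->
  is_derive x (ei i) (cusp x0) ((x - x0) 0 i * (2 * cusp x0 x ^+ 3)^-1).
Proof.
move=> nx; have r0 := cusp_gt0 nx.
have s0 : 0 < Num.sqrt (sqdist x0 x) by rewrite sqrtr_gt0 sqdist_gt0.
have ds := @is_derive_sqrt_comp _ _ (sqdist x0) x _ _ (sqdist_gt0 nx) (is_derive_sqdist x0 x i).
apply: is_derive_eq
  (@is_derive_sqrt_comp _ _ (fun y => Num.sqrt (sqdist x0 y)) x _ _ s0 ds) _.
rewrite -/(cusp x0 x) -cusp_sqr.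
by field; rewrite gt_eqF.
Qed.

Lemma near_neq (R : realType) (V : normedModType R) (x x0 : V) : x != x0 ->
  \forall y \near x, y != x0.
Proof.
move=> nx; apply/nbhs_ballP; exists `|x - x0| => /=.
  by rewrite normr_gt0 subr_eq0.
move=> y; rewrite -ball_normE /= => xy; apply: contraTneq xy => ->.
by rewrite ltxx.
Qed.

Lemma is_derive2_cusp (R : realType) (x0 x : 'rV[R]_2) (i : 'I_2) : x != x0 ->
  is_derive x (ei i) ('D_(ei i) (cusp x0))
    ((2 * cusp x0 x ^+ 3)^-1 - 3 / 4 * (x - x0) 0 i ^+ 2 / cusp x0 x ^+ 7).
Proof.
move=> nx; have r0 := cusp_gt0 nx; have rN0 : cusp x0 x != 0 by rewrite gt_eqF.
have dr := is_derive_cusp i nx.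
have dy := is_derive_coord x x0 i i.
apply: (@near_eq_is_derive _ _ _
    (fun y => (y - x0) 0 i * (2 * cusp x0 y ^+ 3)^-1)).
  have := near_neq nx; apply: filterS => y ny.
  by have /@derive_val -> := is_derive_cusp i ny.
have d3 : is_derive x (ei i) (cst 2 * (cusp x0 : 'rV[R]_2 -> R) ^+ 3)
    (3 * cusp x0 x ^+ 2 * ((x - x0) 0 i / cusp x0 x ^+ 3)).
  apply: is_derive_eq
    (is_deriveM (is_derive_cst (2 : R) x (ei i)) (is_deriveX 3 dr)) _.
  rewrite fctE.
  by rewrite /GRing.scale /=; field.
have n0 : 2 * cusp x0 x ^+ 3 != 0 by rewrite mulf_neq0 // expf_neq0.
pose G : 'rV[R]_2 -> R := cst 2 * (cusp x0 : 'rV[R]_2 -> R) ^+ 3.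
have dV : is_derive x (ei i) (fun y => (G y)^-1)
    (- (G x) ^- 2 *: (3 * cusp x0 x ^+ 2 * ((x - x0) 0 i / cusp x0 x ^+ 3))).
  case: d3 => d3 <-; split; first exact: derivableV.
  by rewrite deriveV.
have -> : (fun y => (y - x0) 0 i * (2 * cusp x0 y ^+ 3)^-1) =
    (fun y => (y - x0) 0 i) * (fun y => (G y)^-1).
  by apply/funext => y.
apply: is_derive_eq (is_deriveM dy dV) _.
rewrite /G fctE /GRing.scale /= eqxx mulr1.
by rewrite -[(_ ^+ 3) x]/(cusp x0 x ^+ 3); field.
Qed.

(** * The barrier and the three possible positions of a minimum *)

(** Regularity at a fixed time, tailored to the expansion of [opA] by the product rule and to the
    second-order test along each axis. *)
Definition C2_slice (R : realType) (Omega : set 'rV[R]_2)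
    (g : 'rV[R]_2 -> R) : Prop :=
  C1_space Omega g /\
  forall i x, Omega x -> derivable ('D_(ei i) g) x (ei i).

Lemma opA_expand (R : realType) (kap g : 'rV[R]_2 -> R) (x : 'rV[R]_2) :
  (forall i, derivable kap x (ei i)) ->
  (forall i, derivable ('D_(ei i) g) x (ei i)) ->
  opA kap g x =
  - \sum_(i < 2) ('D_(ei i) kap x * 'D_(ei i) g x +
                  kap x * 'D_(ei i) ('D_(ei i) g) x).
Proof.
move=> dk dg; congr (- _); apply: eq_bigr => i _.
have E : 'D_(ei i) (fun y => kap y * 'D_(ei i) g y) x =
    kap x *: 'D_(ei i) ('D_(ei i) g) x + 'D_(ei i) g x *: 'D_(ei i) kap x.
  exact: deriveM.
by rewrite E /GRing.scale /=; ring.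
Qed.

Lemma is_derive_perturb (R : realType) (V : normedModType R) (g Z : V -> R)
    (x v : V) (eta dZ : R) :
  derivable g x v -> is_derive x v Z dZ ->
  is_derive x v (fun y => g y + eta * Z y) ('D_v g x + eta * dZ).
Proof.
by move=> /derivableP dg dz; exact: is_deriveD dg (is_deriveZ eta dz).
Qed.

(** The spatial part of the perturbation; the time part (t - t0)^2 is added in
    [minimum_principle]. *)
Definition barrier (R : realType) (x0 q : 'rV[R]_2) (a b : R) (x : 'rV[R]_2) : R :=
  sqdist x0 x - a * dotp (x - x0) q - b * cusp x0 x.

Lemma is_derive_barrier (R : realType) (x0 q x : 'rV[R]_2) (a b : R) (i : 'I_2) :
  x != x0 ->
  is_derive x (ei i) (barrier x0 q a b)
    (2 * (x - x0) 0 i - a * q 0 i - b * ((x - x0) 0 i * (2 * cusp x0 x ^+ 3)^-1)).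
Proof.
move=> nx; have dS := is_derive_sqdist x0 x i.
have dr := is_derive_cusp i nx.
have d0 := is_derive_coord x x0 i 0; have d1 := is_derive_coord x x0 i 1.
pose F j (y : 'rV[R]_2) : R := (y - x0) 0 j.
have -> : barrier x0 q a b =
    sqdist x0 - (a * q 0 0 \*: F 0 + a * q 0 1 \*: F 1) - b \*: cusp x0.
  apply/funext => y; rewrite /barrier !fctE /dotp /F /GRing.scale /=.
  by rewrite /GRing.scale /=; ring.
have dL := is_deriveD (is_deriveZ (a * q 0 0) d0) (is_deriveZ (a * q 0 1) d1).
apply: is_derive_eq (is_deriveB (is_deriveB dS dL) (is_deriveZ b dr)) _.
congr (_ - _ - _); rewrite /GRing.scale /=.
by move: i {dS dr d0 d1 dL}; apply: ord2_ind; rewrite /= ?mulr1 ?mulr0 ?addr0 ?add0r.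
Qed.

Lemma is_derive2_barrier (R : realType) (x0 q x : 'rV[R]_2) (a b : R) (i : 'I_2) :
  x != x0 ->
  is_derive x (ei i) ('D_(ei i) (barrier x0 q a b))
    (2 - b * ((2 * cusp x0 x ^+ 3)^-1
      - 3 / 4 * (x - x0) 0 i ^+ 2 / cusp x0 x ^+ 7)).
Proof.
move=> nx; have dr := is_derive2_cusp i nx.
have dy := is_derive_coord x x0 i i.
pose F (y : 'rV[R]_2) : R := (y - x0) 0 i.
apply: (@near_eq_is_derive _ _ _
    (2 \*: F - cst (a * q 0 i) - b \*: 'D_(ei i) (cusp x0))).
  have := near_neq nx; apply: filterS => y ny.
  have /@derive_val -> := is_derive_barrier q a b i ny.
  rewrite -[LHS]/(2 * F y - a * q 0 i - b * 'D_(ei i) (cusp x0) y).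
  by have /@derive_val -> := is_derive_cusp i ny.
apply: is_derive_eq (is_deriveB (is_deriveB (is_deriveZ 2 dy)
  (is_derive_cst (a * q 0 i) x (ei i))) (is_deriveZ b dr)) _.
by rewrite eqxx /GRing.scale /= mulr1 subr0.
Qed.

(** Here [y] is x - x0, [w] is r^(-3/2), [v] is r^(-7/2), [K] is the gradient of the diffusion
    coefficient, and [G], [H] are the first and second derivatives of the function at a minimum of
    the perturbed one. Both singular contributions are multiples of [b * w]: the diffusion gains
    [b * w * (k1 / 4)], which pays for the drift created by [K]. The remaining bound does not depend
    on the distance to the centre. *)
Lemma barrier_estimate (R : realType)
    (eta a b rho B k1 k2 k q0 q1 y0 y1 w v K0 K1 G0 G1 H0 H1 : R) :
  0 <= eta -> 0 <= a -> 0 <= b -> 0 <= B -> rho <= 1 -> B * rho <= k1 / 4 ->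
  a * (`|q0| + `|q1|) <= 1 -> k1 <= k -> k <= k2 -> 0 <= k ->
  `|y0| <= rho -> `|y1| <= rho -> `|K0| <= B -> `|K1| <= B ->
  y0 ^+ 2 * v + y1 ^+ 2 * v = w -> 0 < w ->
  G0 + eta * (2 * y0 - a * q0 - b * (y0 * (w / 2))) = 0 ->
  G1 + eta * (2 * y1 - a * q1 - b * (y1 * (w / 2))) = 0 ->
  0 <= H0 + eta * (2 - b * (w / 2 - 3 / 4 * y0 ^+ 2 * v)) ->
  0 <= H1 + eta * (2 - b * (w / 2 - 3 / 4 * y1 ^+ 2 * v)) ->
  - (K0 * G0 + k * H0 + (K1 * G1 + k * H1)) <= eta * (5 * B + 4 * k2).
Proof.
move=> eta0 a0 b0 B0 rho1 Brho aq k1k kk2 k0 y0r y1r K0B K1B vw w0 g0 g1 h0 h1.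
have Ky (K y : R) : `|K| <= B -> `|y| <= rho -> `|K * y| <= B * rho.
  by move=> *; rewrite normrM ler_pM.
have Kq (K q : R) : `|K| <= B -> - (K * q) <= B * `|q|.
  move=> KB; apply: le_trans (ler_norm _) _.
  by rewrite normrN normrM ler_wpM2r.
have /ler_normlP[A0 A0'] := Ky _ _ K0B y0r.
have /ler_normlP[A1 A1'] := Ky _ _ K1B y1r.
have B0' := Kq K0 q0 K0B; have B1' := Kq K1 q1 K1B.
set z0 := 2 * y0 - a * q0 - b * (y0 * (w / 2)) in g0.
set z1 := 2 * y1 - a * q1 - b * (y1 * (w / 2)) in g1.
have Brho1 : B * rho <= B by rewrite ler_piMr.
have bw0 : 0 <= b * w by rewrite mulr_ge0 // ltW.
(* The quadratic part contributes at most 4 B, the linear part at most B, and the cusp part is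
   controlled by [B * rho <= k1 / 4]. *)
have Kz : K0 * z0 + K1 * z1 <= 5 * B + b * w * (k1 / 4).
  have -> : K0 * z0 + K1 * z1 = 2 * (K0 * y0 + K1 * y1)
      + a * (- (K0 * q0) - K1 * q1) - b * w * ((K0 * y0 + K1 * y1) / 2).
    by rewrite /z0 /z1; field.
  have S1 : a * (- (K0 * q0) - K1 * q1) <= B.
    apply: (@le_trans _ _ (a * (B * (`|q0| + `|q1|)))).
      by rewrite ler_wpM2l // mulrDr lerD.
    by rewrite mulrCA ler_piMr.
  have S2 : - (b * w * ((K0 * y0 + K1 * y1) / 2)) <= b * w * (k1 / 4).
    by rewrite -mulrN ler_wpM2l //; lra.
  lra.
set h0' := 2 - b * (w / 2 - 3 / 4 * y0 ^+ 2 * v) in h0.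
set h1' := 2 - b * (w / 2 - 3 / 4 * y1 ^+ 2 * v) in h1.
(* In the plane the Laplacian of r^(1/2) is r^(-3/2) / 4. *)
have hE : h0' + h1' = 4 - b * w / 4 by rewrite /h0' /h1' -vw; field.
have kh : k * (h0' + h1') <= 4 * k2 - b * w * (k1 / 4).
  have : b * w * k1 <= b * w * k by rewrite ler_wpM2l.
  by rewrite hE; lra.
have kH : - (k * H0 + k * H1) <= eta * (k * (h0' + h1')).
  have : 0 <= k * ((H0 + eta * h0') + (H1 + eta * h1')).
    by rewrite mulr_ge0 // addr_ge0.
  by lra.
have G0E : G0 = - (eta * z0) by lra.
have G1E : G1 = - (eta * z1) by lra.
have : eta * (K0 * z0 + K1 * z1 + k * (h0' + h1')) <= eta * (5 * B + 4 * k2).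
  by rewrite ler_wpM2l //; lra.
by rewrite G0E G1E; lra.
Qed.

(** The first and second order conditions along the two axes feed [barrier_estimate]. Since the
    bound is [eta] times a constant, a small [eta] makes it incompatible with a strict differential
    inequality. *)
Lemma interior_min (R : realType) (kap g : 'rV[R]_2 -> R)
    (x0 q x : 'rV[R]_2) (eta a b rho B k1 k2 : R) :
  x != x0 -> 0 <= eta -> 0 <= a -> 0 <= b -> 0 <= B ->
  `|x - x0| <= rho -> rho <= 1 -> B * rho <= k1 / 4 ->
  a * (`|q 0 0| + `|q 0 1|) <= 1 -> k1 <= kap x <= k2 ->
  0 <= kap x ->
  (forall i, derivable kap x (ei i)) -> (forall i, `|'D_(ei i) kap x| <= B) ->
  (\forall y \near x, forall i, derivable g y (ei i)) ->
  (forall i, derivable ('D_(ei i) g) x (ei i)) ->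
  (\forall y \near x,
     g x + eta * barrier x0 q a b x <= g y + eta * barrier x0 q a b y) ->
  opA kap g x <= eta * (5 * B + 4 * k2).
Proof.
move=> nx eta0 a0 b0 B0 xrho rho1 Brho aq /andP[k1k kk2] k0 dk kB dg ddg gmin.
set Z := barrier x0 q a b in gmin.
pose W y := g y + eta * Z y.
have dZ i := is_derive_barrier q a b i nx.
have ddZ i := is_derive2_barrier q a b i nx.
pose r := cusp x0 x; have r0 : 0 < r := cusp_gt0 nx.
have D1 i : \forall y \near x, 'D_(ei i) g y + eta * 'D_(ei i) Z y = 'D_(ei i) W y.
  have ny := near_neq nx.
  apply: filterS2 dg ny => y dgy yx.
  have dZy := is_derive_barrier q a b i yx.
  have /@derive_val -> := is_derive_perturb eta (dgy i) dZy.
  by have /@derive_val -> := dZy.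
pose z i := 2 * (x - x0) 0 i - a * q 0 i - b * ((x - x0) 0 i * (2 * r ^+ 3)^-1).
pose zz i := 2 - b * ((2 * r ^+ 3)^-1 - 3 / 4 * (x - x0) 0 i ^+ 2 / r ^+ 7).
have D2 i : is_derive x (ei i) ('D_(ei i) W) ('D_(ei i) ('D_(ei i) g) x + eta * zz i).
  apply: near_eq_is_derive (D1 i) _.
  exact: is_derive_perturb (ddg i) (ddZ i).
have M i : 'D_(ei i) g x + eta * z i = 0 /\
    0 <= 'D_(ei i) ('D_(ei i) g) x + eta * zz i.
  have N1 : \forall y \near x, W x <= W y /\ derivable W y (ei i).
    have ny := near_neq nx; apply: filterS3 gmin dg ny => y gy dgy yx.
    split; first exact: gy.
    by have [] := is_derive_perturb eta (dgy i) (is_derive_barrier q a b i yx).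
  have [N2 _] := D2 i; have := derive2_min N1 N2.
  rewrite (@derive_val _ _ _ _ _ _ _ (D2 i)).
  by rewrite (@derive_val _ _ _ _ _ _ _
       (is_derive_perturb eta (nbhs_singleton dg i) (dZ i))).
rewrite opA_expand // big_ord_recl big_ord1.
have -> : lift ord0 ord0 = 1 :> 'I_2 by exact/val_inj.
have [g0 h0] := M 0; have [g1 h1] := M 1.
have [y0rho y1rho] : `|(x - x0) 0 0| <= rho /\ `|(x - x0) 0 1| <= rho.
  by split; apply: le_trans xrho; exact: rV2_coord_le.
have r4 : (x - x0) 0 0 ^+ 2 + (x - x0) 0 1 ^+ 2 = r ^+ 4.
  by rewrite cusp_pow4 /sqdist /dotp !expr2.
(* [r] is the cusp, so the squared Euclidean distance is [r ^+ 4]. *)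
have r7 : (x - x0) 0 0 ^+ 2 / r ^+ 7 + (x - x0) 0 1 ^+ 2 / r ^+ 7 = (r ^+ 3)^-1.
  by rewrite -mulrDl r4; field; rewrite gt_eqF.
have w2 : (2 * r ^+ 3)^-1 = (r ^+ 3)^-1 / 2 by field; rewrite gt_eqF.
have w0 : 0 < (r ^+ 3)^-1 by rewrite invr_gt0 exprn_gt0.
rewrite /z /zz w2 in g0 g1 h0 h1.
exact: barrier_estimate eta0 a0 b0 B0 rho1 Brho aq k1k kk2 k0 y0rho y1rho
  (kB 0) (kB 1) r7 w0 g0 g1 h0 h1.
Qed.

Lemma barrier_center (R : realType) (x0 q : 'rV[R]_2) (a b : R) :
  barrier x0 q a b x0 = 0.
Proof.
rewrite /barrier /cusp /sqdist subrr /dotp !mxE.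
by rewrite !(mul0r, mulr0, addr0, sqrtr0, subr0).
Qed.

(** Moving inward by [s] orthogonally to [x - x0] adds only [s ^+ 2] to the squared distance and
    cannot decrease the cusp, while the linear term lowers the barrier at the rate
    [- (a * dotp q nu)]. Minimality would then force a negative normal derivative of [g]. *)
Lemma edge_min (R : realType) (g : 'rV[R]_2 -> R) (x0 q x nu : 'rV[R]_2)
    (eta a b L : R) :
  0 < eta -> 0 < a -> 0 <= b ->
  dotp nu nu = 1 -> dotp (x - x0) nu = 0 -> dotp q nu < 0 ->
  (g x - g (x - s *: nu)) / s @[s --> 0^'+] --> L -> 0 <= L ->
  ~ (\forall s \near 0^'+, g x + eta * barrier x0 q a b x <=
       g (x - s *: nu) + eta * barrier x0 q a b (x - s *: nu)).
Proof.
move=> eta0 a0 b0 nu1 xnu qnu gL L0 gmin.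
pose e := - (a * dotp q nu); have e0 : 0 < e by rewrite oppr_gt0 pmulr_rlt0.
suff : L <= - (eta * e / 2).
  by apply/negP; rewrite -ltNge; apply: lt_le_trans L0; rewrite oppr_lt0 divr_gt0 ?mulr_gt0.
apply: (cvgr_to_le gL); near=> s.
have s0 : 0 < s by near: s; exact: nbhs_right_gt.
have se : s < e / 2 by near: s; apply: nbhs_right_lt; rewrite divr_gt0.
have gs : g x + eta * barrier x0 q a b x <=
   g (x - s *: nu) + eta * barrier x0 q a b (x - s *: nu) by near: s.
have xs : x - s *: nu - x0 = (x - x0) + (- s) *: nu by rewrite scaleNr addrAC.
have D2 : sqdist x0 (x - s *: nu) = sqdist x0 x + s ^+ 2.
  rewrite /sqdist xs; move: (x - x0) xnu => y ynu.
  by rewrite dotpDl !dotpDr !dotpZl !dotpZr nu1 (dotpC nu) ynu; ring.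
have Dq : dotp (x - s *: nu - x0) q = dotp (x - x0) q - s * dotp q nu.
  by rewrite xs; move: (x - x0) => y; rewrite dotpDl dotpZl (dotpC nu); ring.
have Dc : cusp x0 x <= cusp x0 (x - s *: nu).
  by rewrite /cusp D2 !ler_wsqrtr // lerDl sqr_ge0.
rewrite ler_pdivrMr //; move: gs; rewrite /barrier D2 Dq.
have : b * cusp x0 x <= b * cusp x0 (x - s *: nu) by rewrite ler_wpM2l.
rewrite -subr_ge0 => H; have {}H := mulr_ge0 (ltW eta0) H.
have : eta * (s * s) <= eta * (s * (e / 2)).
  by rewrite !ler_wpM2l // ltW.
move: H; rewrite /e.
lra.
Unshelve. all: by end_near. Qed.

(** Along the ray [g] and the smooth part of the barrier vary by O(s), whereas the cusp lowers the
    barrier by a multiple of s^(1/2), so the centre cannot be a minimum. *)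
Lemma cusp_min (R : realType) (g : 'rV[R]_2 -> R) (x0 q d : 'rV[R]_2)
    (eta a b : R) :
  0 < eta -> 0 < b -> d != 0 ->
  cvg ((g (x0 + s *: d) - g x0) / s @[s --> 0^'+]) ->
  ~ (\forall s \near 0^'+, g x0 + eta * barrier x0 q a b x0 <=
       g (x0 + s *: d) + eta * barrier x0 q a b (x0 + s *: d)).
Proof.
move=> eta0 b0 d0 /cvg_ex[L gL] gmin.
pose D := dotp d d; have D0 : 0 < D by rewrite lt_def dotp_ge0 dotp_eq0 d0.
pose E := Num.sqrt (Num.sqrt D); have E0 : 0 < E by rewrite !sqrtr_gt0.
(* [M] bounds all linear rates for [s < 1]. Minimality would give [eta * b * E * t <= M * t ^+ 2]
   with [t] the square root of [s], which fails once [t < eta * b * E / M]. *)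
pose M := `|L| + 1 + eta * (D + `|a * dotp d q|).
have M0 : 0 < M.
  apply: (lt_le_trans ltr01); rewrite /M addrAC lerDr addr_ge0 //.
  by rewrite mulr_ge0 ?(ltW eta0) // addr_ge0 // ltW.
have e0 : 0 < eta * b * E / M by rewrite divr_gt0 // !mulr_gt0.
have L1 : L < `|L| + 1 by apply: le_lt_trans (ler_norm L) _; rewrite ltrDl.
have nL := cvgr_le L gL _ L1.
suff : \forall s \near (0 : R)^'+, False by move=> /filter_ex[].
near=> s.
have s0 : 0 < s by near: s; exact: nbhs_right_gt.
have s1 : s < 1 by near: s; exact: nbhs_right_lt.
have se : s < (eta * b * E / M) ^+ 2.
  by near: s; apply: nbhs_right_lt; rewrite exprn_gt0.
have gs : g x0 + eta * barrier x0 q a b x0 <=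
   g (x0 + s *: d) + eta * barrier x0 q a b (x0 + s *: d) by near: s.
have Ls : (g (x0 + s *: d) - g x0) / s <= `|L| + 1.
  near: s; exact: nL.
move: gs; rewrite barrier_center mulr0 addr0 -subr_ge0.
rewrite /barrier /cusp /sqdist.
have -> : x0 + s *: d - x0 = s *: d by rewrite addrC addKr.
rewrite dotpZl dotpZr -/D dotpZl.
have -> : Num.sqrt (Num.sqrt (s * (s * D))) = Num.sqrt s * E.
  by rewrite mulrA -expr2 sqrtrM ?sqr_ge0 // sqrtr_sqr gtr0_norm // sqrtrM ?ltW.
pose t := Num.sqrt s; have t0 : 0 < t by rewrite sqrtr_gt0.
have st : s = t ^+ 2 by rewrite sqr_sqrtr // ltW.
have te : t * M < eta * b * E.
  rewrite -ltr_pdivlMr // -(@ltr_pXn2r _ 2) ?nnegrE -?st // ltW //.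
move=> H; move: Ls; rewrite ler_pdivrMr // => Ls.
have N : - (a * (s * dotp d q)) <= s * `|a * dotp d q|.
  by rewrite mulrCA -mulrN ler_wpM2l ?(ltW s0) // -normrN ler_norm.
have N2 : eta * (s * (s * D)) <= eta * (s * D).
  by rewrite ler_wpM2l ?(ltW eta0) // ler_piMl ?mulr_ge0 // ltW.
have {}N : eta * - (a * (s * dotp d q)) <= eta * (s * `|a * dotp d q|).
  by rewrite ler_wpM2l // ltW.
have : eta * b * E * t <= t * M * t.
  have -> : t * M * t = s * M by rewrite [in RHS]st; ring.
  by move: H Ls N N2; rewrite -/t /M; lra.
by rewrite ler_pM2r // leNgt te.
Unshelve. all: by end_near. Qed.

(** * Compactness and the minimum principle *)

Lemma bounded_closure_compact (R : realType) (n : nat) (Omega : set 'rV[R]_n) :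
  bounded_set Omega -> compact (closure Omega).
Proof.
move=> bO; apply: bounded_closed_compact; last exact: closed_closure.
have [M M0 OM] := pinfty_ex_gt0 bO.
change (\forall N \near +oo, forall x, closure Omega x -> `|x| <= N).
near=> N => x cx; apply: (@le_trans _ _ M); last first.
  by near: N; apply: nbhs_pinfty_ge; rewrite num_real.
suff : closed_ball (0 : 'rV[R]_n) M x.
  by rewrite closed_ballE // /closed_ball_ /= sub0r normrN.
have /closure_id -> : closed (closed_ball (0 : 'rV[R]_n) M).
  exact: closed_ball_closed.
apply: (closureS _ cx) => y Oy; rewrite closed_ballE //.
by rewrite /closed_ball_ /= sub0r normrN; exact: OM.
Unshelve. all: by end_near. Qed.

Lemma cont_ext_bounded (R : realType) (Omega : set 'rV[R]_2) (h : 'rV[R]_2 -> R) :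
  bounded_set Omega -> cont_ext Omega (closure Omega) h ->
  exists2 B, 0 < B & forall x, Omega x -> `|h x| <= B.
Proof.
move=> bO [g [cg hg]].
have cK := continuous_compact cg (bounded_closure_compact bO).
have [B B0 gB] := pinfty_ex_gt0 (compact_bounded cK).
exists B => // x Ox; rewrite hg ?inE //; apply: gB.
by exists x => //; exact: subset_closure.
Qed.

Lemma within_prod_neg (R : realType) (A : set 'rV[R]_2) (I : set R)
    (V : 'rV[R]_2 -> R -> R) (x0 : 'rV[R]_2) (t0 : R) :
  {within A `*` I, continuous (fun z : 'rV[R]_2 * R => V z.1 z.2)} ->
  A x0 -> I t0 -> V x0 t0 < 0 ->
  exists2 e : R, 0 < e & forall x t, A x -> I t ->
    `|x - x0| < e -> `|t - t0| < e -> V x t < 0.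
Proof.
move=> /subspace_continuousP cV Ax It Vneg.
have /(cvgr_lt (V x0 t0)) /(_ 0 Vneg) := cV (x0, t0) (conj Ax It).
move=> nV; have {nV} /nbhs_ballP[e /= e0 H] : \forall z \near (x0, t0),
  (A `*` I) z -> V z.1 z.2 < 0 by exact: nV.
exists e => // x t Ax' It' xe te; apply: (H (x, t)) => //.
by split; rewrite -ball_normE /= distrC.
Qed.

Lemma continuous_barrier (R : realType) (x0 q : 'rV[R]_2) (a b t0 : R) :
  continuous (fun z : 'rV[R]_2 * R => barrier x0 q a b z.1 + (z.2 - t0) ^+ 2).
Proof.
have cc i : continuous (fun z : 'rV[R]_2 * R => (z.1 - x0) 0 i).
  move=> z; rewrite (_ : (fun z : 'rV[R]_2 * R => _) =
      (fun z => z.1 0 i - x0 0 i)); last by apply/funext => y; rewrite !mxE.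
  apply: cvgB; last exact: cvg_cst.
  exact: (continuous_comp cvg_fst (@coord_continuous _ _ _ 0 i _)).
have cS : continuous (fun z : 'rV[R]_2 * R => sqdist x0 z.1).
  by move=> z; apply: cvgD; apply: cvgM; exact: cc.
move=> z; apply: cvgD; last first.
  by apply: cvgM; (apply: cvgB; [exact: cvg_snd|exact: cvg_cst]).
apply: cvgB.
  apply: cvgB; first exact: cS.
  apply: cvgM; first exact: cvg_cst.
  by apply: cvgD; (apply: cvgM; [exact: cc|exact: cvg_cst]).
apply: cvgM; first exact: cvg_cst.
have cq : continuous (fun z : 'rV[R]_2 * R => Num.sqrt (sqdist x0 z.1)).
  move=> y; apply: (continuous_comp (cS y)); exact: sqrt_continuous.
apply: (continuous_comp (cq z)); exact: sqrt_continuous.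
Qed.

Lemma norm_sqr_le_dotp (R : realType) (y : 'rV[R]_2) : `|y| ^+ 2 <= dotp y y.
Proof.
have S : `|y| <= Num.sqrt (dotp y y).
  rewrite rV2_norm_le -![`|y _ _|]sqrtr_sqr /dotp -!expr2.
  by rewrite !ler_wsqrtr // ?lerDl ?lerDr sqr_ge0.
by rewrite -(sqr_sqrtr (dotp_ge0 y)) ler_pXn2r ?nnegrE ?sqrtr_ge0.
Qed.

Lemma near_norm_le (R : realType) (V : normedModType R) (x x0 : V) (r : R) :
  `|x - x0| < r -> \forall y \near x, `|y - x0| <= r.
Proof.
move=> xr; apply/nbhs_ballP; exists (r - `|x - x0|); first by rewrite /= subr_gt0.
move=> y; rewrite -ball_normE /= => yx.
rewrite -(subrKA x); apply: le_trans (ler_normD _ _) _.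
by rewrite distrC -lerBrDr ltW.
Qed.

(** The differential inequality and the boundary sign are asked only where [V] is negative, because
    the perturbed minimum is sought in a neighbourhood where continuity keeps [V] negative. Left
    time derivatives suffice since this neighbourhood contains only times up to [t0]; this also
    covers a minimum at the final time. *)
Lemma minimum_principle (R : realType) (n : nat) (p : 'I_n -> 'rV[R]_2)
    (Omega : set 'rV[R]_2) (T k1 k2 eps : R) (kap : 'rV[R]_2 -> R)
    (V Vt : 'rV[R]_2 -> R -> R) :
  polygon p Omega -> 0 < k1 ->
  (forall x, closure Omega x -> k1 <= kap x <= k2) -> C1_space Omega kap ->
  0 < eps ->
  {within closure Omega `*` `[0, T],
     continuous (fun z : 'rV[R]_2 * R => V z.1 z.2)} ->
  (forall t, 0 < t <= T -> C2_slice Omega (V^~ t)) ->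
  (forall x t, Omega x -> 0 < t <= T ->
     dt_quot V x t s @[s --> t^'-] --> Vt x t) ->
  (forall x t, Omega x -> 0 < t <= T -> V x t < 0 ->
     eps <= Vt x t + opA kap (V^~ t) x) ->
  (forall i x t, open_edge p i x -> 0 < t <= T -> V x t < 0 ->
     0 <= normal_deriv (edge_normal p i) (V^~ t) x) ->
  (forall x, Omega x -> 0 <= V x 0) ->
  forall x t, closure Omega x -> 0 <= t <= T -> 0 <= V x t.
Proof.
move=> poly k10 kapb kapC1 eps0 Vcont Vsp Vtime Vpde Vbc Vinit x' t' cx' t'T.
have [[n3 simple] [oO _] bO _ nrm] := poly.
rewrite leNgt; apply/negP => Vneg'.
have T0 : 0 <= T by case/andP: t'T => h1 h2; exact: le_trans h2.
have cptO := bounded_closure_compact bO.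
have [[x0 t0] /= z0Q z0min] : exists2 z, z \in closure Omega `*` `[0, T] &
    forall y, y \in closure Omega `*` `[0, T] -> V z.1 z.2 <= V y.1 y.2.
  apply: compact_EVT_min Vcont; first by exists (x', t'); split; rewrite //= in_itv.
  by apply: compact_setX => //; exact: segment_compact.
move: z0Q; rewrite inE => -[/= cx0]; rewrite in_itv /= => /andP[t00 t0T].
have Vneg : V x0 t0 < 0.
  apply: le_lt_trans Vneg'; apply: (z0min (x', t')).
  by rewrite inE; split; rewrite //= in_itv.
have {z0min} z0min x t : closure Omega x -> 0 <= t <= T -> V x0 t0 <= V x t.
  by move=> cx tT; apply: (z0min (x, t)); rewrite inE; split; rewrite //= in_itv.
(* The initial condition holds in [Omega] only, while [x0] may be a boundary point; at time 0
   continuity would make [V] negative at some nearby point of [Omega]. *)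
have {}t00 : 0 < t0.
  rewrite lt_def t00 andbT; apply/eqP => t0E; rewrite t0E in Vneg.
  have [|e e0 He] := within_prod_neg Vcont cx0 _ Vneg.
    by rewrite /= in_itv /= lexx.
  have [y [Oy]] := cx0 _ (nbhsx_ballx x0 e e0).
  rewrite -ball_normE /= distrC => ye.
  have := Vinit y Oy; rewrite leNgt He //.
  - exact: subset_closure.
  - by rewrite /= in_itv /= lexx.
  - by rewrite subrr normr0.
have [|e e0 He] := within_prod_neg Vcont cx0 _ Vneg.
  by rewrite /= in_itv /= (ltW t00).
have [q [rho0 rho00 Hedge]] := polygon_local poly x0.
have [d d0 Hray] := interior_ray poly cx0.
have [_ dkap Dkap] := kapC1.
have [B0 B00 HB0] := cont_ext_bounded bO (Dkap 0).
have [B1 B10 HB1] := cont_ext_bounded bO (Dkap 1).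
pose B := B0 + B1; have Bpos : 0 < B by rewrite addr_gt0.
have HB i x : Omega x -> `|'D_(ei i) kap x| <= B.
  move=> Ox; move: i; apply: ord2_ind.
    by apply: le_trans (HB0 x Ox) _; rewrite lerDl ltW.
  by apply: le_trans (HB1 x Ox) _; rewrite lerDr ltW.
(* [e] keeps [V] negative, [rho0] is the range of the local description of the polygon, and the last
   two bounds are those of [barrier_estimate]. *)
have [rho [rho_gt0 rhoe rhorho0 rho1 rhoB]] : exists rho : R,
    [/\ 0 < rho, rho < e, rho < rho0, rho <= 1 & B * rho <= k1 / 4].
  pose m := Num.min (Num.min e rho0) (Num.min 1 (k1 / (4 * B))).
  have m0 : 0 < m.
    by rewrite !lt_min e0 rho00 ltr01 divr_gt0 // mulr_gt0.
  have m2 : m / 2 < m by rewrite ltr_pdivrMr // ltr_pMr // ltr1n.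
  have [me mr m1 mB] : [/\ m <= e, m <= rho0, m <= 1 & m <= k1 / (4 * B)].
    by rewrite !ge_min !lexx !orbT.
  exists (m / 2); split.
  - by rewrite divr_gt0.
  - exact: lt_le_trans me.
  - exact: lt_le_trans mr.
  - by apply: le_trans m1; rewrite ltW.
  - rewrite mulrC -ler_pdivlMr //; apply: le_trans (le_trans (ltW m2) mB) _.
    by rewrite invfM mulrA.
have [tau [tau0 taut0 taurho]] : exists tau : R, [/\ 0 < tau, tau < t0 & tau <= rho].
  have m0 : 0 < Num.min t0 rho by rewrite lt_min t00.
  have m2 : Num.min t0 rho / 2 < Num.min t0 rho.
    by rewrite ltr_pdivrMr // ltr_pMr // ltr1n.
  exists (Num.min t0 rho / 2); split; first by rewrite divr_gt0.
  - by apply: (lt_le_trans m2); rewrite ge_min lexx.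
  - by apply: (le_trans (ltW m2)); rewrite ge_min lexx orbT.
pose Q1 := `|q 0 0| + `|q 0 1|.
have Q10 : 0 <= Q1 by rewrite addr_ge0.
(* In the ball the linear term is at most [tau ^+ 2 / 4], and so is the cusp term because the cusp
   is at most 2 there. Their sum stays below [tau ^+ 2], whence [Zgt]. *)
pose a := tau ^+ 2 / (4 * (Q1 + 1)); pose b := tau ^+ 2 / 8.
have tau2 : 0 < tau ^+ 2 by rewrite exprn_gt0.
have tau1 : tau <= 1 by exact: le_trans rho1.
have a0 : 0 < a by rewrite divr_gt0 // mulr_gt0 // ltr_wpDl.
have b0 : 0 < b by rewrite divr_gt0.
have aQ : a * Q1 <= tau ^+ 2 / 4.
  have -> : tau ^+ 2 / 4 = a * (Q1 + 1).
    by rewrite /a; field; rewrite gt_eqF // ltr_wpDl.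
  by rewrite ler_wpM2l ?lerDl // ltW.
have aQ1 : a * Q1 <= 1.
  apply: (le_trans aQ); have : tau ^+ 2 <= 1 by rewrite expr_le1 // ltW.
  by clear; lra.
have k120 : 0 <= 5 * B + 4 * k2.
  have /andP[h1 h2] := kapb x0 cx0.
  by rewrite addr_ge0 // mulr_ge0 // ltW // (lt_le_trans k10) // (le_trans h1).
(* The summand [5 * B + 4 * k2] comes from [interior_min] and the summand 2 from the time derivative
   of (t - t0)^2, as [tau <= 1]. *)
pose C := 5 * B + 4 * k2 + 2; have C0 : 0 < C by rewrite ltr_wpDl.
pose eta := eps / (2 * C); have eta0 : 0 < eta by rewrite divr_gt0 // mulr_gt0.
have etaC : eta * C < eps.
  have -> : eta * C = eps / 2 by rewrite /eta; field; rewrite gt_eqF.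
  by rewrite ltr_pdivrMr // ltr_pMr // ltr1n.
pose Z := barrier x0 q a b.
pose K := (closure Omega `&` closed_ball x0 rho) `*` `[t0 - tau, t0].
have inB x : closed_ball x0 rho x <-> `|x - x0| <= rho.
  by rewrite closed_ballE // /closed_ball_ /= distrC.
have KQ : K `<=` closure Omega `*` `[0, T].
  move=> [x t] [/= [cx _]]; rewrite in_itv /= => /andP[h1 h2]; split=> //=.
  by rewrite in_itv /= (le_trans h2 t0T) andbT (le_trans _ h1) // subr_ge0 ltW.
have z0K : K (x0, t0).
  split; first by split=> //; apply/inB; rewrite subrr normr0 ltW.
  by rewrite /= in_itv /= lexx andbT gerBl ltW.
have [[x1 t1] z1K z1min] : exists2 z, z \in K & forall y, y \in K ->
    V z.1 z.2 + eta * (Z z.1 + (z.2 - t0) ^+ 2) <=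
    V y.1 y.2 + eta * (Z y.1 + (y.2 - t0) ^+ 2).
  apply: (@compact_EVT_min _ _
    (fun z => V z.1 z.2 + eta * (Z z.1 + (z.2 - t0) ^+ 2))).
  - by exists (x0, t0).
  - apply: compact_setX; last exact: segment_compact.
    by apply: compact_closedI => //; exact: closed_ball_closed.
  - apply: within_continuousD; first exact: continuous_subspaceW Vcont.
    apply: continuous_subspaceT => z; apply: cvgM; first exact: cvg_cst.
    exact: continuous_barrier.
move: z1K; rewrite inE => -[/= [cx1 /inB x1rho]].
rewrite in_itv /= => /andP[t1l t1u].
have {z1min} Wmin x t : closure Omega x -> `|x - x0| <= rho -> t0 - tau <= t <= t0 ->
    V x1 t1 + eta * (Z x1 + (t1 - t0) ^+ 2) <= V x t + eta * (Z x + (t - t0) ^+ 2).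
  move=> cx xr tt; apply: (z1min (x, t)); rewrite inE; split => /=.
    by split=> //; apply/inB.
  by rewrite in_itv.
have t10 : 0 < t1 by rewrite (lt_le_trans _ t1l) // subr_gt0.
have t1T : t1 <= T by exact: le_trans t0T.
have t1T' : 0 < t1 <= T by rewrite t10.
have V1neg : V x1 t1 < 0.
  apply: He => //.
  - by rewrite /= in_itv /= t1T ltW.
  - exact: le_lt_trans rhoe.
  - rewrite ler0_norm ?subr_le0 // opprB; apply: le_lt_trans rhoe.
    by apply: le_trans taurho; clear -t1l; lra.
(* The perturbation vanishes at (x0, t0), where [V] itself is minimal. *)
have Zle : Z x1 + (t1 - t0) ^+ 2 <= 0.
  have := Wmin x0 t0 cx0; rewrite subrr normr0 (ltW rho_gt0) lexx gerBl (ltW tau0).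
  rewrite /Z barrier_center subrr expr0n /= addr0 mulr0 addr0 => /(_ isT isT).
  have := z0min x1 t1 cx1; rewrite t1T (ltW t10) => /(_ isT) h1 h2.
  by rewrite -(pmulr_rle0 _ eta0); clear -h1 h2; lra.
have [y0 y1] : `|(x1 - x0) 0 0| <= rho /\ `|(x1 - x0) 0 1| <= rho.
  by split; apply: le_trans x1rho; exact: rV2_coord_le.
have Zgt : sqdist x0 x1 - tau ^+ 2 < Z x1.
  have Dq : a * dotp (x1 - x0) q <= a * Q1.
    rewrite ler_wpM2l ?(ltW a0) // /dotp lerD //.
      apply: le_trans (ler_norm _) _; rewrite normrM ler_piMl //.
      exact: le_trans rho1.
    apply: le_trans (ler_norm _) _; rewrite normrM ler_piMl //.
    exact: le_trans rho1.
  have sq (y : R) : `|y| <= rho -> y ^+ 2 <= 1.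
    by move=> yr; rewrite -real_normK ?num_real // expr_le1 // (le_trans yr).
  have cle : cusp x0 x1 <= 2.
    rewrite -(@ler_pXn2r _ 4) ?nnegrE ?sqrtr_ge0 // cusp_pow4 /sqdist /dotp.
    by have := sq _ y0; have := sq _ y1; rewrite !expr2; clear; lra.
  have Dc : b * cusp x0 x1 <= b * 2 by rewrite ler_wpM2l // ltW.
  by rewrite /Z /barrier; move: Dq Dc aQ tau2; rewrite {2}/b; clear; lra.
(* By [Zgt] the perturbation is positive on the lateral sphere, where the squared distance is at
   least [rho ^+ 2 >= tau ^+ 2], and at the bottom time [t0 - tau]; [Zle] excludes both. *)
have x1lt : `|x1 - x0| < rho.
  rewrite lt_neqAle x1rho andbT; apply: contraTneq Zle => E.
  rewrite -ltNge; apply: (lt_le_trans _ (_ : Z x1 <= _)); last by rewrite lerDl sqr_ge0.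
  apply: le_lt_trans Zgt; rewrite subr_ge0.
  have : `|x1 - x0| ^+ 2 <= sqdist x0 x1 by exact: norm_sqr_le_dotp.
  apply: le_trans; rewrite E ler_pXn2r ?nnegrE // ltW //.
have t1lt : t0 - tau < t1.
  rewrite lt_neqAle t1l andbT; apply: contraTneq Zle => E.
  rewrite -ltNge; have -> : (t1 - t0) ^+ 2 = tau ^+ 2 by rewrite -E; ring.
  by have := Zgt; have := dotp_ge0 (x1 - x0); rewrite -/(sqdist x0 x1); clear; lra.
have gmin x : closure Omega x -> `|x - x0| <= rho ->
    V x1 t1 + eta * Z x1 <= V x t1 + eta * Z x.
  by move=> cx xr; have := Wmin x t1 cx xr; rewrite t1l t1u => /(_ isT); clear; lra.
have [gC1 ggd] := Vsp t1 t1T'.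
have [gcont gd gD] := gC1.
(* Three positions remain: the centre, excluded by [cusp_min]; a point of [Omega], excluded by the
   differential inequality; a point of an open edge, excluded by [edge_min]. *)
have [x1E|nx1] := eqVneq x1 x0.
  have nray : \forall s \near 0^'+, Omega (x0 + s *: d).
    near=> s; apply: Hray; apply/andP; split; first by near: s; exact: nbhs_right_gt.
    by near: s; apply: nbhs_right_le.
  apply: (@cusp_min _ (V^~ t1) x0 q d eta a b) => //.
    exact: ray_quotient_cvg nray gC1.
  rewrite x1E in gmin; near=> s.
  apply: gmin; first by apply: subset_closure; near: s.
  have s0 : 0 < s by near: s; exact: nbhs_right_gt.
  have sd : s < rho / `|d|.
    by near: s; apply: nbhs_right_lt; rewrite divr_gt0 // normr_gt0.
  rewrite addrC addKr normrZ gtr0_norm // -ler_pdivlMr ?normr_gt0 //.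
  exact: ltW.
have [Ox1|nOx1] := pselect (Omega x1).
  have nO : \forall y \near x1, Omega y by exact: open_nbhs_nbhs.
  have A1 : opA kap (V^~ t1) x1 <= eta * (5 * B + 4 * k2).
    apply: (@interior_min _ kap (V^~ t1) x0 q x1 eta a b rho B k1 k2) => //.
    - exact: ltW.
    - exact: ltW.
    - exact: ltW.
    - exact: ltW.
    - exact: kapb.
    - have /andP[h1 _] := kapb x1 cx1; exact: le_trans (ltW k10) h1.
    - by move=> i; exact: dkap.
    - by move=> i; exact: HB.
    - by apply: filterS nO => y Oy i; exact: gd.
    - by move=> i; exact: ggd.
    - have nB := near_norm_le x1lt; apply: filterS2 nO nB => y Oy.
      by apply: gmin; exact: subset_closure.
  (* Comparison with earlier times [s] bounds the left quotient by [eta * (2 * t0 - s - t1)], and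
     both times are within [tau <= 1] of [t0]. *)
  have A2 : Vt x1 t1 <= eta * 2.
    apply: (cvgr_to_le (Vtime x1 t1 Ox1 t1T')); near=> s.
    have st1 : s < t1 by near: s; exact: nbhs_left_lt.
    have st0 : t0 - tau < s by near: s; exact: nbhs_left_gt.
    rewrite /dt_quot ler_ndivrMr ?subr_lt0 //.
    have := Wmin x1 s cx1 x1rho; rewrite (ltW st0) (le_trans (ltW st1)) // => /(_ isT).
    have : eta * ((s - t0) ^+ 2 - (t1 - t0) ^+ 2) <= eta * (2 * (t1 - s)).
      rewrite ler_wpM2l ?(ltW eta0) //.
      have -> : (s - t0) ^+ 2 - (t1 - t0) ^+ 2 = (2 * t0 - s - t1) * (t1 - s) by ring.
      by rewrite ler_wpM2r //; [clear -st1|clear -st0 t1l tau1]; lra.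
    by clear; lra.
  have := Vpde x1 t1 Ox1 t1T' V1neg.
  by move: etaC A1 A2; rewrite /C; clear; lra.
have bx1 : bnd Omega x1.
  by split=> //; rewrite (interior_id Omega).1.
have [i [xi qi xnu]] := Hedge x1 bx1 (lt_trans x1lt rhorho0) nx1.
have sO : \forall s \near 0^'+, Omega (x1 - s *: edge_normal p i).
  by have := nrm i x1 xi; apply: filterS => s [].
apply: (@edge_min _ (V^~ t1) x0 q x1 (edge_normal p i) eta a b
    (normal_deriv (edge_normal p i) (V^~ t1) x1)) => //.
- exact: ltW.
- by apply: edge_normal_unit; exact: edge_dir_neq0 simple i.
- exact: normal_deriv_cvg sO gC1.
- exact: Vbc.
near=> s; apply: gmin; first by apply: subset_closure; near: s.
have s0 : 0 < s by near: s; exact: nbhs_right_gt.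
have nu0 : 0 < `|edge_normal p i| + 1 by rewrite ltr_wpDl.
have sd : s < (rho - `|x1 - x0|) / (`|edge_normal p i| + 1).
  by near: s; apply: nbhs_right_lt; rewrite divr_gt0 // subr_gt0.
rewrite addrAC; apply: le_trans (ler_normB _ _) _.
rewrite normrZ gtr0_norm // -lerBrDl.
move: sd; rewrite ltr_pdivlMr // => /ltW; apply: le_trans.
by rewrite ler_wpM2l ?lerDl // ltW.
Unshelve. all: by end_near. Qed.

(** * Linearity of the operators and regularity of differences *)

Lemma derive_sub_near (R : realType) (Omega : set 'rV[R]_2)
    (g h : 'rV[R]_2 -> R) (i : 'I_2) (x : 'rV[R]_2) :
  open Omega -> Omega x ->
  (forall y, Omega y -> derivable g y (ei i)) ->
  (forall y, Omega y -> derivable h y (ei i)) ->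
  \forall y \near x, 'D_(ei i) g y - 'D_(ei i) h y = 'D_(ei i) (fun z => g z - h z) y.
Proof.
move=> oO Ox dg dh.
have nO : \forall y \near x, Omega y by exact: open_nbhs_nbhs.
by apply: filterS nO => y Oy; rewrite -(deriveB (dg y Oy) (dh y Oy)).
Qed.

Lemma C2_sliceB (R : realType) (Omega : set 'rV[R]_2) (g h : 'rV[R]_2 -> R) :
  open Omega -> C2_slice Omega g -> C2_slice Omega h ->
  C2_slice Omega (fun x => g x - h x).
Proof.
move=> oO [[cg dg Dg] ddg] [[ch dh Dh] ddh].
split; first split.
- exact: within_continuousB.
- by move=> i x Ox; apply: derivableB; [exact: dg|exact: dh].
- move=> i; have [G [cG gG]] := Dg i; have [H [cH hH]] := Dh i.
  exists (fun x => G x - H x); split; first exact: within_continuousB.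
  move=> x; rewrite inE => Ox.
  rewrite -(nbhs_singleton (derive_sub_near oO Ox (dg i) (dh i))).
  by rewrite gG ?hH ?inE.
- move=> i x Ox; apply: (near_eq_derivable (derive_sub_near oO Ox (dg i) (dh i))).
  by apply: derivableB; [exact: ddg|exact: ddh].
Qed.

Lemma opAB (R : realType) (Omega : set 'rV[R]_2) (kap g h : 'rV[R]_2 -> R)
    (x : 'rV[R]_2) :
  open Omega -> Omega x -> C1_space Omega kap ->
  C2_slice Omega g -> C2_slice Omega h ->
  opA kap (fun y => g y - h y) x = opA kap g x - opA kap h x.
Proof.
move=> oO Ox [_ dk _] Cg Ch; have [[_ dg _] ddg] := Cg; have [[_ dh _] ddh] := Ch.
have [_ ddgh] := C2_sliceB oO Cg Ch.
have dkx i := dk i x Ox.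
rewrite (opA_expand dkx (fun i => ddgh i x Ox)) (opA_expand dkx (fun i => ddg i x Ox)).
rewrite (opA_expand dkx (fun i => ddh i x Ox)).
rewrite -opprD -sumrB; congr (- _); apply: eq_bigr => i _.
have N := derive_sub_near oO Ox (dg i) (dh i).
rewrite -(nbhs_singleton N) -(near_eq_derive _ N).
have E : 'D_(ei i) (fun y => 'D_(ei i) g y - 'D_(ei i) h y) x =
    'D_(ei i) ('D_(ei i) g) x - 'D_(ei i) ('D_(ei i) h) x.
  exact: deriveB (ddg i x Ox) (ddh i x Ox).
by rewrite E !mulrBr opprD addrACA.
Qed.

(** [psi] is tied to the final value of [u] only on [Omega]; openness makes the nested derivatives
    agree nevertheless. *)
Lemma opA_eq (R : realType) (Omega : set 'rV[R]_2) (kap g h : 'rV[R]_2 -> R)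
    (x : 'rV[R]_2) :
  open Omega -> Omega x -> (forall y, Omega y -> g y = h y) ->
  opA kap g x = opA kap h x.
Proof.
move=> oO Ox gh; apply: (congr1 -%R); apply: eq_bigr => i _.
apply: near_eq_derive.
have nO : \forall y \near x, Omega y by exact: open_nbhs_nbhs.
apply: filterS nO => y Oy; congr (_ * _); apply: near_eq_derive.
have nOy : \forall z \near y, Omega z by exact: open_nbhs_nbhs.
by apply: filterS nOy => z; exact: gh.
Qed.

Lemma C2_slice_cst (R : realType) (Omega : set 'rV[R]_2) (a : R) :
  C2_slice Omega (cst a).
Proof.
have D0 i : 'D_(ei i) (cst a : 'rV[R]_2 -> R) = cst 0.
  by apply/funext => x; exact: derive_cst.
split; first split.
- by apply: continuous_subspaceT; exact: cst_continuous.
- by move=> i x _; exact: derivable_cst.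
- move=> i; rewrite D0; exists (cst 0); split=> //.
  by apply: continuous_subspaceT; exact: cst_continuous.
- by move=> i x _; rewrite D0; exact: derivable_cst.
Qed.

Lemma opA_cst (R : realType) (kap : 'rV[R]_2 -> R) (a : R) (x : 'rV[R]_2) :
  opA kap (cst a) x = 0.
Proof.
rewrite /opA big1 ?oppr0 // => i _.
rewrite (_ : (fun y => _) = cst 0) ?derive_cst //.
by apply/funext => y; rewrite [X in _ * X]derive_cst mulr0.
Qed.

Lemma normal_deriv_cst (R : realType) (nu x : 'rV[R]_2) (a : R) :
  normal_deriv nu (cst a) x = 0.
Proof.
rewrite /normal_deriv (_ : (fun s => _) = cst 0) ?lim_cst //.
by apply/funext => s; rewrite /= subrr mul0r.
Qed.

Lemma normal_derivB (R : realType) (Omega : set 'rV[R]_2)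
    (g h : 'rV[R]_2 -> R) (x nu : 'rV[R]_2) :
  open Omega -> closure Omega x -> (\forall s \near 0^'+, Omega (x - s *: nu)) ->
  C1_space Omega g -> C1_space Omega h ->
  normal_deriv nu (fun y => g y - h y) x = normal_deriv nu g x - normal_deriv nu h x.
Proof.
move=> oO cx sO Cg Ch; apply: cvg_lim => //.
rewrite (_ : (fun s => _) = fun s =>
    (g x - g (x - s *: nu)) / s - (h x - h (x - s *: nu)) / s); last first.
  by apply/funext => s; rewrite -mulrBl; congr (_ / _); ring.
by apply: cvgB; [exact: normal_deriv_cvg sO Cg|exact: normal_deriv_cvg sO Ch].
Qed.

(* Only left derivatives in time are required: unlike dt T, they are not affected
   by restricting the time interval. *)
Definition parabolic_reg (R : realType) (Omega : set 'rV[R]_2) (T : R)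
    (v vt : 'rV[R]_2 -> R -> R) : Prop :=
  [/\ {within closure Omega `*` `[0, T],
        continuous (fun z : 'rV[R]_2 * R => v z.1 z.2)},
      forall t, 0 < t <= T -> C2_slice Omega (v^~ t) &
      forall x t, Omega x -> 0 < t <= T ->
        dt_quot v x t s @[s --> t^'-] --> vt x t].

Lemma parabolic_regB (R : realType) (Omega : set 'rV[R]_2) (T : R)
    (v vt w wt : 'rV[R]_2 -> R -> R) :
  open Omega -> parabolic_reg Omega T v vt -> parabolic_reg Omega T w wt ->
  parabolic_reg Omega T (fun x t => v x t - w x t) (fun x t => vt x t - wt x t).
Proof.
move=> oO [cv Cv lv] [cw Cw lw]; split.
- exact: within_continuousB.
- by move=> t tT; exact: C2_sliceB (Cv t tT) (Cw t tT).
- move=> x t Ox tT; rewrite (_ : dt_quot _ x t = fun s => dt_quot v x t s - dt_quot w x t s).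
    by apply: cvgB; [exact: lv|exact: lw].
  by apply/funext => s; rewrite /dt_quot -mulrBl; congr (_ / _); ring.
Qed.

Lemma parabolic_reg_linear (R : realType) (Omega : set 'rV[R]_2) (T a : R) :
  parabolic_reg Omega T (fun _ t => a * t) (fun _ _ => a).
Proof.
split.
- apply: continuous_subspaceT => z; apply: cvgM; first exact: cvg_cst.
  exact: cvg_snd.
- by move=> t _; exact: C2_slice_cst.
- move=> x t _ _; apply: cvg_near_cst; near=> s.
  have st : s < t by near: s; exact: nbhs_left_lt.
  by rewrite /dt_quot -mulrBr mulfK // subr_eq0 lt_eqF.
Unshelve. all: by end_near. Qed.

(** * Weak maximum principle for supersolutions *)

Section Comparison.
Context {R : realType} {n : nat} {p : 'I_n -> 'rV[R]_2} {Omega : set 'rV[R]_2}.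
Context {k1 k2 : R} {kap mu : 'rV[R]_2 -> R}.
Hypotheses (poly : polygon p Omega) (k1_gt0 : 0 < k1)
  (kap_bounds : forall x, closure Omega x -> k1 <= kap x <= k2)
  (kap_C1 : C1_space Omega kap) (mu_ge0 : forall x, bnd Omega x -> 0 <= mu x).

Let oO : open Omega. Proof. by case: poly => _ []. Qed.

Lemma edge_inward (i : 'I_n) (x : 'rV[R]_2) : open_edge p i x ->
  \forall s \near 0^'+, Omega (x - s *: edge_normal p i).
Proof. by case: poly => _ _ _ _ nrm xi; have := nrm i x xi; apply: filterS => s []. Qed.

Lemma edge_closure (i : 'I_n) (x : 'rV[R]_2) : open_edge p i x -> closure Omega x.
Proof. by move=> /(open_edge_bnd poly)[]. Qed.

Lemma robin_bcB (g h : 'rV[R]_2 -> R) : C1_space Omega g -> C1_space Omega h ->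
  robin_bc p kap mu g -> robin_bc p kap mu h ->
  robin_bc p kap mu (fun x => g x - h x).
Proof.
move=> Cg Ch bg bh i x xi.
rewrite (normal_derivB oO (edge_closure xi) (edge_inward xi) Cg Ch).
by have := bg i x xi; have := bh i x xi; lra.
Qed.

Lemma comparison (T : R) (c : 'rV[R]_2 -> R) (v vt : 'rV[R]_2 -> R -> R) :
  (forall x, Omega x -> 0 <= c x) -> parabolic_reg Omega T v vt ->
  (forall x t, Omega x -> 0 < t <= T ->
     0 <= vt x t + opA kap (v^~ t) x + c x * v x t) ->
  (forall t, 0 < t <= T -> robin_bc p kap mu (v^~ t)) ->
  (forall x, Omega x -> 0 <= v x 0) ->
  forall x t, Omega x -> 0 <= t <= T -> 0 <= v x t.
Proof.
move=> c0 vreg pde bc init.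
suff H e : 0 < e -> forall x t, Omega x -> 0 <= t <= T -> 0 <= v x t - (- e) * t.
  move=> x t Ox tT; rewrite leNgt; apply/negP => vneg.
  have t0 : 0 < t + 1 by case/andP: tT => t0 _; rewrite ltr_wpDl.
  (* With this value of [e], v + e t equals v / (t + 1), still negative; the summand 1 allows
     [t = 0]. *)
  have e0 : 0 < - v x t / (t + 1) by rewrite divr_gt0 // oppr_gt0.
  have := H _ e0 x t Ox tT; rewrite mulNr opprK leNgt => /negP; apply.
  rewrite -ltrBrDl sub0r mulrAC ltr_pdivrMr //.
  by rewrite ltr_pM2l ?oppr_gt0 // ltrDl.
move=> e0 x t Ox tT.
have [cv Cv lv] := vreg.
have [cV CV lV] := parabolic_regB oO vreg (parabolic_reg_linear Omega T (- e)).
have Vneg y s : 0 < s -> v y s - (- e) * s < 0 -> v y s < 0.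
  by move=> s0; have := mulr_gt0 e0 s0; lra.
apply: (@minimum_principle _ _ p Omega T k1 k2 e kap
  (fun x t => v x t - (- e) * t) (fun x t => vt x t - (- e)) poly k1_gt0) => //.
- move=> y s Oy sT /Vneg Hneg.
  have vs : v y s < 0 by apply: Hneg; case/andP: sT.
  rewrite (opAB oO Oy kap_C1 (Cv s sT) (C2_slice_cst Omega (- e * s))) opA_cst.
  have := pde y s Oy sT; have : c y * v y s <= 0.
    by rewrite mulr_ge0_le0 ?c0 // ltW.
  by lra.
- move=> i y s yi sT /Vneg Hneg.
  have vs : v y s < 0 by apply: Hneg; case/andP: sT.
  rewrite (normal_derivB oO (edge_closure yi) (edge_inward yi) (Cv s sT).1
    (C2_slice_cst Omega (- e * s)).1) normal_deriv_cst subr0.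
  have /andP[kk _] := kap_bounds (edge_closure yi).
  have k0 : 0 < kap y by exact: lt_le_trans kk.
  rewrite -(pmulr_rge0 _ k0); have := bc s sT i y yi.
  have : mu y * v y s <= 0.
    apply: mulr_ge0_le0; last exact: ltW.
    by apply: mu_ge0; exact: (open_edge_bnd poly yi).
  by lra.
- by move=> y Oy; rewrite mulr0 subr0; exact: init.
- exact: subset_closure.
Qed.

End Comparison.

(** * Time slices, left time derivatives and time shifts *)

Lemma within_continuous_compose (X Y Z : topologicalType) (A : set X) (B : set Y)
    (h : X -> Y) (g : Y -> Z) :
  {within B, continuous g} -> continuous h -> (forall x, A x -> B (h x)) ->
  {within A, continuous (fun x => g (h x))}.
Proof.
move=> /subspace_continuousP cg ch AB; apply/subspace_continuousP => x Ax.
have gx := cg (h x) (AB x Ax).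
apply: cvg_comp; last exact: gx.
move=> P nP; have {}nP : \forall y \near h x, B y -> P y by exact: nP.
have nQ : \forall z \near x, B (h z) -> P (h z) by exact: (ch x _ nP).
change (\forall z \near x, A z -> P (h z)).
near=> z => Az; have Q : B (h z) -> P (h z) by near: z; exact: nQ.
exact: (Q (AB z Az)).
Unshelve. all: by end_near. Qed.

Lemma pair_continuousl (X Y : topologicalType) (y : Y) :
  continuous (fun x : X => (x, y)).
Proof.
move=> x P [[A B] /= [xA yB] AB].
have {}xA : \forall z \near x, A z by exact: xA.
change (\forall z \near x, P (z, y)); near=> z; apply: AB; split=> /=.
  by near: z; exact: xA.
exact: nbhs_singleton yB.
Unshelve. all: by end_near. Qed.

Lemma pair_continuousr (X Y : topologicalType) (x : X) :
  continuous (fun y : Y => (x, y)).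
Proof.
move=> y P [[A B] /= [xA yB] AB].
have {}yB : \forall z \near y, B z by exact: yB.
change (\forall z \near y, P (x, z)); near=> z; apply: AB; split=> /=.
  exact: nbhs_singleton xA.
by near: z; exact: yB.
Unshelve. all: by end_near. Qed.

Lemma slice_continuous (R : realType) (A : set 'rV[R]_2) (I : set R) (t : R)
    (F : 'rV[R]_2 * R -> R) :
  {within A `*` I, continuous F} -> I t -> {within A, continuous (fun x => F (x, t))}.
Proof.
move=> cF It.
apply: (within_continuous_compose (h := fun x : 'rV[R]_2 => (x, t)) cF) => [x|x Ax];
  last by split.
exact: pair_continuousl.
Qed.

Lemma smooth_C2_slice (R : realType) (Omega : set 'rV[R]_2) (T t : R)
    (v : 'rV[R]_2 -> R -> R) :
  {within closure Omega `*` `[0, T],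
    continuous (fun z : 'rV[R]_2 * R => v z.1 z.2)} ->
  C2_space Omega T v -> t \in `[0, T] -> C2_slice Omega (v^~ t).
Proof.
move=> cv [dv ddv Dv _] tT; split; first split.
- exact: (slice_continuous cv tT).
- by move=> i x Ox; exact: dv.
- move=> i; have [G [cG gG]] := Dv i.
  exists (fun x => G (x, t)); split; first exact: (slice_continuous cG tT).
  by move=> x Ox; rewrite -gG // inE; split=> //=; rewrite inE in Ox.
- by move=> i x Ox; exact: ddv.
Qed.

Lemma at_left_within (R : realType) (T t : R) (h : R -> R) (l : R) :
  0 < t <= T -> h s @[s --> within `[0, T] t^'] --> l -> h s @[s --> t^'-] --> l.
Proof.
move=> /andP[t0 tT]; apply: cvg_trans; apply: cvg_app => P nP.
have : \forall s \near t^', s \in `[0, T] -> P s by exact: nP.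
move=> [e /= e0 H].
change (\forall s \near t^'-, P s); near=> s.
have s0 : 0 < s by near: s; exact: nbhs_left_gt.
have st : s < t by near: s; exact: nbhs_left_lt.
have se : t - e < s by near: s; apply: nbhs_left_gt; rewrite gtrBl.
apply: H.
- by rewrite /= gtr0_norm ?subr_gt0 // ltrBlDr -ltrBlDl.
- by rewrite lt_eqF.
- by rewrite in_itv /= ltW // (le_trans (ltW st)).
Unshelve. all: by end_near. Qed.

Lemma smooth_parabolic_reg (R : realType) (Omega : set 'rV[R]_2) (T : R)
    (v : 'rV[R]_2 -> R -> R) :
  smooth Omega T v -> parabolic_reg Omega T v (dt T v).
Proof.
move=> [[cv dv _] C2v _ _]; split=> //.
- move=> t /andP[t0 tT]; apply: (smooth_C2_slice cv C2v).
  by rewrite in_itv /= ltW.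
- move=> x t Ox tT; apply: (at_left_within tT); apply: dv.
    exact: subset_closure.
  by case/andP: tT => t0 tT; rewrite in_itv /= ltW.
Qed.

Lemma parabolic_reg_shift (R : realType) (Omega : set 'rV[R]_2) (T h : R)
    (v vt : 'rV[R]_2 -> R -> R) :
  0 <= h -> parabolic_reg Omega T v vt ->
  parabolic_reg Omega (T - h) (fun x t => v x (t + h)) (fun x t => vt x (t + h)).
Proof.
move=> h0 [cv Cv lv].
have shift_itv t : 0 < t <= T - h -> 0 < t + h <= T.
  by move=> /andP[t0 tT]; rewrite ltr_wpDr // -lerBrDr.
split.
- apply: (within_continuous_compose (h := fun z : 'rV[R]_2 * R => (z.1, z.2 + h)) cv).
    move=> z; apply: (@cvg_pair _ _ _ _ (nbhs z.1) (nbhs (z.2 + h))).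
      exact: cvg_fst.
    by apply: cvgD; [exact: cvg_snd|exact: cvg_cst].
  move=> [x t] [/= cx]; rewrite in_itv /= => /andP[t0 tT]; split=> //=.
  by rewrite in_itv /= addr_ge0 // -lerBrDr.
- by move=> t /shift_itv; exact: Cv.
- move=> x t Ox /shift_itv /(lv x _ Ox) lx.
  have sh : (fun s : R => s + h) s @[s --> t^'-] --> (t + h)^'-.
    move=> P [e /= e0 H]; exists e => //= s /= st slt; apply: H => /=.
      by rewrite opprD addrACA subrr addr0.
    by rewrite ltrD2r.
  rewrite (_ : dt_quot _ x t = fun s => dt_quot v x (t + h) (s + h)).
    by apply: cvg_comp; [exact: sh|exact: lx].
  by apply/funext => s; rewrite /dt_quot; congr (_ / _); ring.
Qed.

Lemma dt_left_ge0 (R : realType) (Omega : set 'rV[R]_2) (T : R)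
    (v vt : 'rV[R]_2 -> R -> R) (x : 'rV[R]_2) :
  parabolic_reg Omega T v vt -> Omega x -> 0 < T ->
  (forall s, 0 <= s -> s <= T -> v x s <= v x T) -> 0 <= vt x T.
Proof.
move=> [_ _ lv] Ox T0 vmon.
have TT : 0 < T <= T by rewrite T0 lexx.
apply: (cvgr_to_ge (lv x T Ox TT)); near=> s.
have sT : s < T by near: s; exact: nbhs_left_lt.
have s0 : 0 < s by near: s; exact: nbhs_left_gt.
rewrite /dt_quot -mulrNN -invrN mulr_ge0 ?invr_ge0 ?opprB ?subr_ge0 ?(ltW sT) //.
by apply: vmon; exact: ltW.
Unshelve. all: by end_near. Qed.

(** At times strictly inside [[0, T]] the restricted quotients are eventually the ordinary ones, so
    the usual monotonicity criterion applies, with mere continuity at the two ends. *)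
Lemma dt_gt0_monotone (R : realType) (Omega : set 'rV[R]_2) (T : R)
    (f : 'rV[R]_2 -> R -> R) (x : 'rV[R]_2) (s t : R) :
  C1_time Omega T f -> Omega x ->
  (forall r, 0 < r <= T -> 0 < dt T f x r) ->
  0 <= s -> s <= t -> t <= T -> f x s <= f x t.
Proof.
move=> [cf df _] Ox fincr s0 st tT.
have df' r : r \in `]0, T[ -> is_derive r 1 (f x) (dt T f x r).
  rewrite in_itv /= => /andP[r0 rT].
  have : dt_quot f x r q @[q --> within `[0, T] r^'] --> dt T f x r.
    apply: df; first exact: subset_closure.
    by rewrite in_itv /= !ltW.
  move=> Q; have {}Q : h^-1 *: ((f x \o shift r) (h *: 1) - f x r) @[h --> 0^']
      --> dt T f x r.
    apply: cvg_trans Q => P nP.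
    have [e /= e0 H] : \forall q \near r^', q \in `[0, T] -> P (dt_quot f x r q).
      exact: nP.
    exists (Num.min e (Num.min r (T - r))); first by rewrite /= !lt_min e0 r0 subr_gt0.
    move=> h /=; rewrite sub0r normrN !lt_min => /and3P[he hr hT] h0.
    have -> : h^-1 *: (f x (h%:A + r) - f x r) = dt_quot f x r (h + r).
      by rewrite /dt_quot addrK [_%:A]mulr1 /GRing.scale /= mulrC.
    apply: H.
    - by rewrite /= opprD addrCA subrr addr0 normrN.
    - by rewrite -subr_eq0 addrK.
    - move: hr hT; rewrite !ltr_norml in_itv /= => /andP[h1 h2] /andP[h3 h4].
      by apply/andP; split; lra.
  by split; [apply/cvg_ex; exists (dt T f x r)|exact: cvg_lim Q].
have [T0|T0] := ltrP 0 T; last first.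
  by rewrite (_ : s = t) //; apply/le_anti; rewrite st; lra.
have cfx : {within `[0, T], continuous (f x)}.
  apply: (within_continuous_compose (h := fun r : R => (x, r)) cf).
    exact: pair_continuousr.
  by move=> r rT; split=> //; exact: subset_closure.
apply: (ger0_derive1_le_cc _ _ cfx) => //.
- by move=> r /df' [].
- move=> r rT; have /@derive_val := df' r rT; rewrite -derive1E => ->.
  by apply/ltW/fincr; move: rT; rewrite in_itv /= => /andP[-> /ltW].
- by rewrite in_itv /= s0 (le_trans st).
- by rewrite in_itv /= tT andbT (le_trans s0).
Qed.

(** * Monotonicity in time of solutions and of their differences *)

Lemma residual_ge0 (R : realFieldType) (a a' b b' c v v' g g' : R) :
  a + b + c * v = g -> a' + b' + c * v' = g' -> g <= g' ->
  0 <= a' - a + (b' - b) + c * (v' - v).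
Proof. by move=> <- <-; rewrite -subr_ge0; lra. Qed.

Lemma residual_sub (R : realFieldType) (a a' b b' c c' v v' g : R) :
  a + b + c * v = g -> a' + b' + c' * v' = g ->
  a - a' + (b - b') + c' * (v - v') = (c' - c) * v.
Proof. by move=> <-; lra. Qed.

Section Monotone.
Context {R : realType} {n : nat} {p : 'I_n -> 'rV[R]_2} {Omega : set 'rV[R]_2}.
Context {k1 k2 : R} {kap mu : 'rV[R]_2 -> R}.
Hypotheses (poly : polygon p Omega) (k1_gt0 : 0 < k1)
  (kap_bounds : forall x, closure Omega x -> k1 <= kap x <= k2)
  (kap_C1 : C1_space Omega kap) (mu_ge0 : forall x, bnd Omega x -> 0 <= mu x).

(* Comparing v with its own time shifts replaces the differentiation of the
   equation and of the boundary condition in t. *)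
Lemma time_monotone (T : R) (c : 'rV[R]_2 -> R) (v vt g : 'rV[R]_2 -> R -> R) :
  (forall x, Omega x -> 0 <= c x) -> parabolic_reg Omega T v vt ->
  (forall x t, Omega x -> 0 < t <= T ->
     vt x t + opA kap (v^~ t) x + c x * v x t = g x t) ->
  (forall t, 0 < t <= T -> robin_bc p kap mu (v^~ t)) ->
  (forall x, Omega x -> v x 0 = 0) ->
  (forall x t, Omega x -> 0 <= t <= T -> 0 <= g x t) ->
  (forall x s t, Omega x -> 0 <= s -> s <= t -> t <= T -> g x s <= g x t) ->
  forall x s t, Omega x -> 0 <= s -> s <= t -> t <= T -> v x s <= v x t.
Proof.
move=> c0 vreg pde bc v0 g0 gmon x s t Ox s0 st tT.
have oO : open Omega by case: poly => _ [].
(* Nonnegativity supplies the initial condition for the shifted difference, which at time 0 is v(h)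
   - v(0) = v(h). *)
have vpos y r : Omega y -> 0 <= r <= T -> 0 <= v y r.
  apply: (comparison poly k1_gt0 kap_bounds kap_C1 mu_ge0 c0 vreg _ bc).
    move=> z q Oz qT; rewrite pde // g0 //.
    by case/andP: qT => q0 ->; rewrite ltW.
  by move=> z Oz; rewrite v0.
pose h := t - s; have h0 : 0 <= h by rewrite subr_ge0.
have hreg := parabolic_regB oO (parabolic_reg_shift h0 vreg)
  (_ : parabolic_reg Omega (T - h) v vt).
have ThT : T - h <= T by rewrite gerBl.
have lift_itv r : 0 < r <= T - h -> 0 < r <= T.
  by move=> /andP[-> rT]; exact: le_trans ThT.
have shift_itv r : 0 < r <= T - h -> 0 < r + h <= T.
  by move=> /andP[r0 rT]; rewrite ltr_wpDr // -lerBrDr.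
have {}hreg : parabolic_reg Omega (T - h) (fun x t => v x (t + h) - v x t)
    (fun x t => vt x (t + h) - vt x t).
  apply: hreg; have [cv Cv lv] := vreg; split.
  - apply: continuous_subspaceW cv => -[y r] [/= cy]; rewrite in_itv /=.
    by move=> /andP[r0 rT]; split; rewrite //= in_itv /= r0 (le_trans rT).
  - by move=> r /lift_itv; exact: Cv.
  - by move=> y r Oy /lift_itv; exact: lv.
have [_ Cv _] := vreg.
have := comparison poly k1_gt0 kap_bounds kap_C1 mu_ge0 c0 hreg.
have -> : v x t = v x (s + h) by rewrite /h addrC subrK.
rewrite -subr_ge0 => /(_ _ _ _ x s Ox); apply.
- move=> y r Oy rT; have rT1 := lift_itv r rT; have rT2 := shift_itv r rT.
  rewrite (opAB oO Oy kap_C1 (Cv _ rT2) (Cv _ rT1)).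
  apply: (residual_ge0 (pde y r Oy rT1) (pde y (r + h) Oy rT2)).
  apply: gmon => //; first by case/andP: rT1 => /ltW.
    by rewrite lerDl.
  by case/andP: rT2.
- move=> r rT; have rT1 := lift_itv r rT; have rT2 := shift_itv r rT.
  by apply: (robin_bcB poly (Cv _ rT2).1 (Cv _ rT1).1); exact: bc.
- move=> y Oy; rewrite add0r v0 // subr0; apply: vpos => //.
  by rewrite h0 /= /h lerBlDr (le_trans tT) // lerDl.
- by rewrite s0 /= lerBrDl /h subrK.
Qed.

Lemma solves_monotone (T : R) (f : 'rV[R]_2 -> R -> R) (c : 'rV[R]_2 -> R)
    (v : 'rV[R]_2 -> R -> R) :
  smooth Omega T v -> solves p Omega T kap mu f c v ->
  (forall x, Omega x -> 0 <= c x) -> (forall x, Omega x -> 0 <= f x 0) ->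
  (forall x s t, Omega x -> 0 <= s -> s <= t -> t <= T -> f x s <= f x t) ->
  forall x s t, Omega x -> 0 <= s -> s <= t -> t <= T -> v x s <= v x t.
Proof.
move=> /smooth_parabolic_reg vreg [pde bc v0] c0 f0 fmon.
apply: (time_monotone c0 vreg pde bc v0 _ fmon) => x t Ox /andP[t0 tT].
by apply: le_trans (f0 x Ox) _; exact: fmon.
Qed.

(** The difference solves the problem with coefficient [c'] and right-hand side [(c' - c) * v],
    which is nonnegative and nondecreasing in time because [v] is. Its monotonicity yields both the
    order of the solutions, as it starts from 0, and the sign of its time derivative at [T]. *)
Lemma solves_diff_monotone (T : R) (f : 'rV[R]_2 -> R -> R)
    (c c' : 'rV[R]_2 -> R) (v v' : 'rV[R]_2 -> R -> R) :
  smooth Omega T v -> solves p Omega T kap mu f c v ->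
  smooth Omega T v' -> solves p Omega T kap mu f c' v' ->
  (forall x, Omega x -> 0 <= c' x) -> (forall x, Omega x -> c x <= c' x) ->
  (forall x s t, Omega x -> 0 <= s -> s <= t -> t <= T -> v x s <= v x t) ->
  forall x s t, Omega x -> 0 <= s -> s <= t -> t <= T ->
    v x s - v' x s <= v x t - v' x t.
Proof.
move=> /smooth_parabolic_reg vreg [pde bc v0] /smooth_parabolic_reg vreg'.
move=> [pde' bc' v0'] c'0 cc' vmon.
have oO : open Omega by case: poly => _ [].
have [[_ Cv _] [_ Cv' _]] := (vreg, vreg').
have vge0 x t : Omega x -> 0 <= t <= T -> 0 <= v x t.
  by move=> Ox /andP[t0 tT]; rewrite -(v0 x Ox); exact: vmon.
apply: (time_monotone (g := fun x t => (c' x - c x) * v x t) c'0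
  (parabolic_regB oO vreg vreg')).
- move=> x t Ox tT.
  rewrite (opAB oO Ox kap_C1 (Cv t tT) (Cv' t tT)).
  exact: residual_sub (pde x t Ox tT) (pde' x t Ox tT).
- by move=> t tT; apply: (robin_bcB poly (Cv t tT).1 (Cv' t tT).1); [exact: bc|exact: bc'].
- by move=> x Ox; rewrite v0 // v0' // subrr.
- by move=> x t Ox tT; rewrite mulr_ge0 ?vge0 // subr_ge0 cc'.
- by move=> x s t Ox s0 st tT; rewrite ler_wpM2l ?subr_ge0 ?cc' // vmon.
Qed.

End Monotone.

(** * The monotone iteration *)

Unset Implicit Arguments.

Theorem theorem1 (R : realType) (n : nat) (p : 'I_n -> 'rV[R]_2)
    (Omega : set 'rV[R]_2) (T k1 k2 : R)
    (kap mu : 'rV[R]_2 -> R) (f : 'rV[R]_2 -> R -> R)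
    (u : 'rV[R]_2 -> R -> R) (c psi : 'rV[R]_2 -> R)
    (us : nat -> 'rV[R]_2 -> R -> R) (cs : nat -> 'rV[R]_2 -> R)
    (Omega_polygon : polygon p Omega)
    (T_gt0 : 0 < T)
    (k1_gt0 : 0 < k1)
    (kap_bounds : forall x, closure Omega x -> k1 <= kap x <= k2)
    (kap_C1 : C1_space Omega kap)
    (mu_ge0 : forall x, bnd Omega x -> 0 <= mu x)
    (mu_bounded : exists M, forall i x, open_edge p i x -> `|mu x| <= M)
    (mu_cont : forall i, {within open_edge p i, continuous mu})
    (f_C1 : C1_time Omega T f)
    (f_init : forall x, Omega x -> f x 0 = 0)
    (f_incr : forall x t, Omega x -> 0 < t <= T -> 0 < dt T f x t)
    (u_smooth : smooth Omega T u)
    (c_cont : cont_ext Omega (closure Omega) c)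
    (c_ge0 : forall x, Omega x -> 0 <= c x)
    (u_solves : solves p Omega T kap mu f c u)
    (u_final : forall x, Omega x -> u x T = psi x)
    (psi_gt0 : forall x, Omega x -> 0 < psi x)
    (us_smooth : forall k, smooth Omega T (us k))
    (cs_cont : forall k, cont_ext Omega (closure Omega) (cs k))
    (cs0 : forall x, Omega x -> cs 0%N x * psi x = - opA kap psi x + f x T)
    (us_solves : forall k, solves p Omega T kap mu f (cs k) (us k))
    (csS : forall k x, Omega x ->
       cs k.+1 x * psi x = - dt T (us k) x T - opA kap psi x + f x T) :
  forall k : nat, (1 <= k)%N -> forall x t, Omega x -> 0 < t <= T ->
    (us k.-1 x t <= us k x t <= u x t) /\ (c x <= cs k x <= cs k.-1 x).
Proof.
have oO : open Omega by case: Omega_polygon => _ [].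
have TT : 0 < T <= T by rewrite T_gt0 lexx.
have f0 x : Omega x -> 0 <= f x 0 by move=> Ox; rewrite f_init.
have fmon x s t : Omega x -> 0 <= s -> s <= t -> t <= T -> f x s <= f x t.
  by move=> Ox; apply: (dt_gt0_monotone f_C1 Ox) => r; exact: f_incr.
have mon := solves_monotone Omega_polygon k1_gt0 kap_bounds kap_C1 mu_ge0.
have dmon := solves_diff_monotone Omega_polygon k1_gt0 kap_bounds kap_C1 mu_ge0.
have ureg := smooth_parabolic_reg u_smooth.
have usreg k := smooth_parabolic_reg (us_smooth k).
have umon := mon T f c u u_smooth u_solves c_ge0 f0 fmon.
have dt_ge0 v vt x : parabolic_reg Omega T v vt -> Omega x ->
    (forall x s t, Omega x -> 0 <= s -> s <= t -> t <= T -> v x s <= v x t) ->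
    0 <= vt x T.
  move=> vreg Ox vmon; apply: (dt_left_ge0 vreg Ox T_gt0) => s s0 sT.
  exact: vmon.
(* The equation for [u] at time [T] rewrites the data defining the iterates: (c^0 - c) psi is the
   time derivative of u at [T], and (c^(k+1) - c) psi is that of u - u^k. *)
have fE x : Omega x -> - opA kap psi x + f x T = dt T u x T + c x * psi x.
  move=> Ox; have [pde _ _] := u_solves; have := pde x T Ox TT.
  rewrite (opA_eq _ oO Ox u_final) u_final // => <-.
  by rewrite (addrC (dt T u x T)) -addrA addKr.
have c_le0 x : Omega x -> c x <= cs 0%N x.
  move=> Ox; rewrite -(ler_pM2r (psi_gt0 x Ox)) cs0 // fE // lerDr.
  exact: dt_ge0 ureg Ox umon.
(* Induction: c <= c^k makes u - u^k nondecreasing in time, so its derivative at [T], which is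
   (c^(k+1) - c) psi, is nonnegative. *)
have c_le k x : Omega x -> c x <= cs k x.
  elim: k x => [|k IH] x Ox; first exact: c_le0.
  rewrite -(ler_pM2r (psi_gt0 x Ox)) csS // -addrA fE // addrA lerDr addrC.
  have csk0 y : Omega y -> 0 <= cs k y.
    by move=> Oy; exact: le_trans (c_ge0 y Oy) (IH y Oy).
  exact: (dt_ge0 _ _ x (parabolic_regB oO ureg (usreg k)) Ox
    (dmon T f c (cs k) u (us k) u_smooth u_solves (us_smooth k) (us_solves k)
      csk0 IH umon)).
have cs_ge0 k x : Omega x -> 0 <= cs k x.
  by move=> Ox; exact: le_trans (c_ge0 x Ox) (c_le k x Ox).
have usmon k := mon T f (cs k) (us k) (us_smooth k) (us_solves k) (cs_ge0 k) f0 fmon.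
(* Here (c^0 - c^1) psi is the time derivative of u^0 at [T], and (c^(k+1) - c^(k+2)) psi is that of
   u^(k+1) - u^k, nondecreasing by the induction hypothesis c^(k+1) <= c^k. *)
have cs_dec k x : Omega x -> cs k.+1 x <= cs k x.
  elim: k x => [|k IH] x Ox; rewrite -(ler_pM2r (psi_gt0 x Ox)).
    rewrite csS // cs0 // -addrA gerDr oppr_le0.
    exact: dt_ge0 (usreg 0%N) Ox (usmon 0%N).
  rewrite csS // csS // -!addrA lerD2r lerN2 -subr_ge0.
  exact: (dt_ge0 _ _ x (parabolic_regB oO (usreg k.+1) (usreg k)) Ox
    (dmon T f (cs k.+1) (cs k) (us k.+1) (us k) (us_smooth k.+1)
      (us_solves k.+1) (us_smooth k) (us_solves k) (cs_ge0 k) IH (usmon k.+1))).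
case=> [//|k] _ x t Ox /andP[t0 tT] /=.
have us0 j : us j x 0 = 0 by have [_ _ ->] := us_solves j.
have u0 : u x 0 = 0 by have [_ _ ->] := u_solves.
(* Both inequalities between solutions come from nondecreasing differences that vanish at time 0. *)
split; apply/andP; split; [| | exact: c_le | exact: cs_dec].
- have := dmon T f (cs k.+1) (cs k) (us k.+1) (us k) (us_smooth k.+1)
    (us_solves k.+1) (us_smooth k) (us_solves k) (cs_ge0 k) (cs_dec k)
    (usmon k.+1) x 0 t Ox (lexx 0) (ltW t0) tT.
  by rewrite !us0 subrr subr_ge0.
- have := dmon T f c (cs k.+1) u (us k.+1) u_smooth u_solves (us_smooth k.+1)
    (us_solves k.+1) (cs_ge0 k.+1) (c_le k.+1) umon x 0 t Ox (lexx 0) (ltW t0) tT.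
  by rewrite us0 u0 subrr subr_ge0.
Qed.
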